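(* Let $A(z)=a_3z^3+a_2z^2+a_1z+a_0$ and $B(z)=b_3z^3+b_2z^2+b_1z+b_0$ be polynomials with complex coefficients (of degree at most three), and let $w$ be a positive weight function on $[0,2\pi]$ satisfying $$\frac{d}{d\theta}\left[A(e^{i\theta})w(\theta)\right]=B(e^{i\theta})w(\theta),\qquad 0\le\theta\le 2\pi,$$ and $A(1)[w(2\pi)-w(0)]=0$. Let $\widehat A,U_n,V_n,W_n,Y_n$ be the polynomials defined in the context. Then, for $n\ge3$, the associated monic orthogonal polynomial on the unit circle $\Phi_n$ satisfies $$\begin{aligned} zA(z)\Phi_n''(z)&+\big\{[zA(z)]'-U_n(z)+\Theta(|V_n|)\,zA(z)Y_n(z)[\widehat A(z)]^{-1}\big\}\Phi_n'(z)\\ &-\big\{\Theta(|V_n|)[Y_n(z)U_n(z)-V_n(z)W_n(z)][\widehat A(z)]^{-1}+U_n'(z)\big\}\Phi_n(z)=V_n'(z)\Phi_n^*(z), \end{aligned}$$ where $\Theta$ is the unit step function with the convention $\Theta(0)=0$.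
   Context: Inner product: $\langle f,g\rangle=\int_0^{2\pi}f(e^{i\theta})\overline{g(e^{i\theta})}\,w(\theta)\,d\theta$. $\{\Phi_n\}_{n\ge0}$ is the sequence of monic orthogonal polynomials, $\deg\Phi_n=n$, $\langle\Phi_n,\Phi_m\rangle=0$ for $n\ne m$, written $\Phi_n(z)=z^n+\ell_{n,n-1}z^{n-1}+\cdots+\ell_{n,1}z+\ell_{n,0}$. The reversed polynomial is $\Phi_n^*(z)=z^n\overline{\Phi_n(1/\overline z)}$. Verblunsky coefficients: $\alpha_{n-1}=-\overline{\ell}_{n,0}=-\overline{\Phi_n(0)}$ for $n\ge1$, and $\alpha_{-1}=-1$. Prime denotes $d/dz$. The Pearson equation is understood with $\theta\mapsto A(e^{i\theta})w(\theta)$ absolutely continuous on $[0,2\pi]$ and the equation holding almost everywhere; $A(1)[w(2\pi)-w(0)]$ denotes the difference of the boundary values of $A(e^{i\theta})w(\theta)$ at $2\pi$ and $0$. Coefficients: $$\mathfrak{p}_{n,n}=(ib_3+2a_3)\overline{\alpha}_n,\quad \mathfrak{t}_{n,n}=(ib_3+a_3)\overline{\alpha}_{n+1}(1-|\alpha_n|^2)+(ib_2+a_2+a_3\ell_{n+1,n})\overline{\alpha}_n,$$ $$\mathfrak{s}_{n,n}=ib_1+(n+1)a_1-a_0\overline{\ell}_{n,n-1}-[ib_0+(n+1)a_0]\alpha_n\overline{\alpha}_{n-1},$$ $$\mathfrak{s}_{n,n+1}=na_2+a_3[(n-1)\ell_{n,n-1}-n\ell_{n+2,n+1}]+(ib_3+2a_3)\overline{\alpha}_n\alpha_{n-1}.$$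 Polynomials: $$\widehat{A}(z)=\overline{a}_0z^3+\overline{a}_1z^2+\overline{a}_2z+\overline{a}_3,$$ $$U_n(z)=na_3z^3+(\mathfrak{s}_{n,n+1}+na_3\overline{\alpha}_{n+1}\alpha_n)z^2+\mathfrak{s}_{n,n}z+ib_0+na_0,$$ $$V_n(z)=[ib_3-(n-2)a_3]\overline{\alpha}_nz^2-(\mathfrak{s}_{n,n+1}\overline{\alpha}_n+na_3\overline{\alpha}_{n+1}-\mathfrak{t}_{n,n})z+(ib_0+na_0)\overline{\alpha}_{n-1},$$ $$W_n(z)=(-i\overline{b}_0+n\overline{a}_0)\alpha_{n-1}z^2-(\overline{\mathfrak{s}}_{n,n+1}\alpha_n+n\overline{a}_3\alpha_{n+1}-\overline{\mathfrak{t}}_{n,n})z+\overline{\mathfrak{p}}_{n,n}-n\overline{a}_3\alpha_n,$$ $$Y_n(z)=(-i\overline{b}_0)z^2+(\overline{\mathfrak{s}}_{n,n}-n\overline{a}_1)z+\overline{\mathfrak{s}}_{n,n+1}+n\overline{a}_3\alpha_{n+1}\overline{\alpha}_n-n\overline{a}_2.$$ The factor $\Theta(|V_n|)$ equals $0$ if $V_n$ is the zero polynomial and $1$ otherwise. The equation is an identity of rational functions, valid at every $z$ with $\widehat A(z)\neq0$. *)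

(* Defs.v *)
From HB Require Import structures.
From mathcomp Require Import all_boot all_order all_algebra.
From mathcomp Require Import complex.
From mathcomp Require Import all_classical all_reals all_analysis.

Set Implicit Arguments.
Unset Strict Implicit.
Unset Printing Implicit Defensive.

Import Order.TTheory GRing.Theory Num.Theory.
Import numFieldNormedType.Exports.

Local Open Scope classical_set_scope.
Local Open Scope ring_scope.

(* ['i] and [z^*] are the generic ones of numClosedFieldType; on R[i] they are
   convertible to [Complex 0 1] and [conjc]. *)

Definition expi (R : realType) (t : R) : R[i] := (cos t +i* sin t)%C.

(* The library has no absolute continuity for functions on an interval; this is
   the usual epsilon-delta definition, with degenerate intervals allowed.
   The library's modulus on R[i] is itself a (real) element of R[i], hence the
   projection [complex.Re]. *)
Definition abs_continuous (R : realType) (a b : R) (f : R -> R[i]) : Prop :=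
  forall e : R, 0 < e -> exists2 d : R, 0 < d &
    forall (m : nat) (x y : 'I_m -> R),
      (forall k, a <= x k /\ x k <= y k /\ y k <= b) ->
      trivIset [set: 'I_m] (fun k => `]x k, y k[%classic) ->
      \sum_(k < m) (y k - x k) < d ->
      \sum_(k < m) complex.Re `|f (y k) - f (x k)| < e.

(* R[i] carries no normed module structure over R in the library, so the
   derivative and the integral of a complex function of a real variable are
   taken on its real and imaginary parts. *)
Definition has_cderiv (R : realType) (f : R -> R[i]) (t : R) (l : R[i]) : Prop :=
  is_derive t 1 (fun s : R => complex.Re (f s)) (complex.Re l) /\
  is_derive t 1 (fun s : R => complex.Im (f s)) (complex.Im l).

Definition cintegral (R : realType) (D : set R) (f : R -> R[i]) : R[i] :=
  (Rintegral (@lebesgue_measure R) D (fun t => complex.Re (f t)) +i*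
   Rintegral (@lebesgue_measure R) D (fun t => complex.Im (f t)))%C.

(* Positivity is only required almost everywhere, so that weights vanishing at
   isolated points, such as sin(t/2)^2, are included. *)
Definition positive_weight (R : realType) (w : R -> R) : Prop :=
  (@lebesgue_measure R).-integrable `[0, 2 * pi] (EFin \o w) /\
  {ae @lebesgue_measure R, forall t, t \in `[0, 2 * pi]%R -> 0 < w t}.

Definition inner (R : realType) (w : R -> R) (f g : R[i] -> R[i]) : R[i] :=
  cintegral `[0, 2 * pi] (fun t => f (expi t) * (g (expi t))^* * (w t)%:C%C).

Definition monic_opuc (R : realType) (w : R -> R) (Phi : nat -> {poly R[i]}) :
    Prop :=
  (forall n, Phi n \is monic /\ size (Phi n) = n.+1) /\
  (forall n m, n != m -> inner w (horner (Phi n)) (horner (Phi m)) = 0).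

Definition pearson (R : realType) (A B : {poly R[i]}) (w : R -> R) : Prop :=
  abs_continuous 0 (2 * pi) (fun t => A.[expi t] * (w t)%:C%C) /\
  {ae @lebesgue_measure R, forall t, t \in `[0, 2 * pi]%R ->
     has_cderiv (fun s => A.[expi s] * (w s)%:C%C) t (B.[expi t] * (w t)%:C%C)}.

(* The reversed polynomial of degree index n, z^n (p(1/z^* ))^*; see
   [horner_reversed]. *)
Definition reversed (R : realType) (n : nat) (p : {poly R[i]}) : {poly R[i]} :=
  \poly_(k < n.+1) (p`_(n - k))^*.

Lemma horner_reversed (R : realType) (n : nat) (p : {poly R[i]}) (z : R[i]) :
  (size p <= n.+1)%N -> z != 0 ->
  (reversed n p).[z] = z ^+ n * (p.[(z^*)^-1])^*.
Proof.
move=> sp z0; rewrite horner_poly (horner_coef_wide _ sp) rmorph_sum mulr_sumr.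
rewrite (reindex_inj rev_ord_inj) /=; apply: eq_bigr => k _.
have kn : (k <= n)%N by rewrite -ltnS.
rewrite subSS subKn // rmorphM rmorphXn fmorphV [X in X^-1]conjCK mulrCA; congr (_ * _).
by rewrite exprVn; apply: (canRL (mulfK _)); rewrite ?expf_neq0 // -exprD subnK.
Qed.

(* The Verblunsky coefficient alpha_n for n >= 0.  The value alpha_(-1) = -1 is
   not representable and not needed. *)
Definition verblunsky (R : realType) (Phi : nat -> {poly R[i]}) (n : nat) :
  R[i] := - ((Phi n.+1).[0])^*.

(* In the coefficients below, a_k is [A`_k], b_k is [B`_k], l_(n,k) is
   [(Phi n)`_k], and n is meant to be positive, so that [n.-1] is n - 1. *)

Definition p_coef (R : realType) (A B : {poly R[i]}) (Phi : nat -> {poly R[i]})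
    (n : nat) : R[i] :=
  let alpha := verblunsky Phi in
  ('i * B`_3 + 2 * A`_3) * (alpha n)^*.

Definition t_coef (R : realType) (A B : {poly R[i]}) (Phi : nat -> {poly R[i]})
    (n : nat) : R[i] :=
  let alpha := verblunsky Phi in
  ('i * B`_3 + A`_3) * (alpha n.+1)^* * (1 - `|alpha n| ^+ 2)
  + ('i * B`_2 + A`_2 + A`_3 * (Phi n.+1)`_n) * (alpha n)^*.

(* s_(n,n) *)
Definition s_coef (R : realType) (A B : {poly R[i]}) (Phi : nat -> {poly R[i]})
    (n : nat) : R[i] :=
  let alpha := verblunsky Phi in
  'i * B`_1 + n.+1%:R * A`_1 - A`_0 * ((Phi n)`_n.-1)^*
  - ('i * B`_0 + n.+1%:R * A`_0) * alpha n * (alpha n.-1)^*.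

(* s_(n,n+1) *)
Definition s1_coef (R : realType) (A B : {poly R[i]}) (Phi : nat -> {poly R[i]})
    (n : nat) : R[i] :=
  let alpha := verblunsky Phi in
  n%:R * A`_2
  + A`_3 * ((n%:R - 1) * (Phi n)`_n.-1 - n%:R * (Phi n.+2)`_n.+1)
  + ('i * B`_3 + 2 * A`_3) * (alpha n)^* * alpha n.-1.

Definition Ahat (R : realType) (A : {poly R[i]}) : {poly R[i]} :=
  (A`_0)^* *: 'X^3 + (A`_1)^* *: 'X^2 + (A`_2)^* *: 'X + ((A`_3)^*)%:P.

Definition U_poly (R : realType) (A B : {poly R[i]}) (Phi : nat -> {poly R[i]})
    (n : nat) : {poly R[i]} :=
  let alpha := verblunsky Phi in
  (n%:R * A`_3) *: 'X^3
  + (s1_coef A B Phi n + n%:R * A`_3 * (alpha n.+1)^* * alpha n) *: 'X^2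
  + s_coef A B Phi n *: 'X
  + ('i * B`_0 + n%:R * A`_0)%:P.

Definition V_poly (R : realType) (A B : {poly R[i]}) (Phi : nat -> {poly R[i]})
    (n : nat) : {poly R[i]} :=
  let alpha := verblunsky Phi in
  (('i * B`_3 - (n%:R - 2) * A`_3) * (alpha n)^*) *: 'X^2
  - (s1_coef A B Phi n * (alpha n)^* + n%:R * A`_3 * (alpha n.+1)^*
     - t_coef A B Phi n) *: 'X
  + (('i * B`_0 + n%:R * A`_0) * (alpha n.-1)^*)%:P.

Definition W_poly (R : realType) (A B : {poly R[i]}) (Phi : nat -> {poly R[i]})
    (n : nat) : {poly R[i]} :=
  let alpha := verblunsky Phi in
  ((- 'i * (B`_0)^* + n%:R * (A`_0)^*) * alpha n.-1) *: 'X^2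
  - ((s1_coef A B Phi n)^* * alpha n + n%:R * (A`_3)^* * alpha n.+1
     - (t_coef A B Phi n)^*) *: 'X
  + ((p_coef A B Phi n)^* - n%:R * (A`_3)^* * alpha n)%:P.

Definition Y_poly (R : realType) (A B : {poly R[i]}) (Phi : nat -> {poly R[i]})
    (n : nat) : {poly R[i]} :=
  let alpha := verblunsky Phi in
  (- 'i * (B`_0)^*) *: 'X^2
  + ((s_coef A B Phi n)^* - n%:R * (A`_1)^*) *: 'X
  + ((s1_coef A B Phi n)^* + n%:R * (A`_3)^* * alpha n.+1 * (alpha n)^*
     - n%:R * (A`_2)^*)%:P.

(* Theta(|V|), with Theta the unit step and Theta(0) = 0. *)
Definition step_of (R : realType) (V : {poly R[i]}) : R[i] :=
  if V == 0 then 0 else 1.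

(* Main.v *)
(* Integrating d/dt [z^m A w] over the period, z = e^(it), the Pearson equation becomes
   the moment identity <z A p', z^k> = <(k A + i B) p, z^k> for every polynomial p and
   integer k.  Hence z A Phi_n' is orthogonal to z^3, ..., z^(n-1), and
     z A Phi_n' = U_n Phi_n + V_n Phi_n^*
   with U_n, V_n of degrees 3 and 2, whose coefficients are read off the remaining
   values of k by means of the Szego recurrence.  Reversing this relation gives
     Ahat (Phi_n^* )' = - (Y_n Phi_n^* + W_n Phi_n),
   and the differential equation is the derivative of the first relation, where
   V_n (Phi_n^* )' is eliminated by the second and V_n Phi_n^* by the first.

   The vanishing of the integral over the period is the fundamental theorem of
   calculus for absolutely continuous F: with G the indefinite integral of F', the
   function F - G has derivative 0 off a null set, and a gauge argument shows that it
   is constant. *)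

Require Import Defs.
From HB Require Import structures.
From mathcomp Require Import all_boot all_order all_algebra.
From mathcomp Require Import complex.
From mathcomp Require Import all_classical all_reals all_analysis.
From mathcomp Require Import measurable_realfun.
From mathcomp Require Import zify ring lra.

Set Implicit Arguments.
Unset Strict Implicit.
Unset Printing Implicit Defensive.

Import Order.TTheory GRing.Theory Num.Theory.
Import numFieldNormedType.Exports.

Local Open Scope classical_set_scope.
Local Open Scope ring_scope.

(** * The fundamental theorem of calculus for absolutely continuous functions *)

(* Cousin's lemma, stated for an additive relation between endpoints, so that no
   tagged partition has to be built. *)
Lemma interval_induction (R : realType) (a b : R) (P : R -> R -> Prop) :
  a <= b ->
  (forall u v w, a <= u -> u <= v -> v <= w -> w <= b ->
     P u v -> P v w -> P u w) ->
  (forall t, a <= t -> t <= b -> exists2 d, 0 < d & forall u v,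
     a <= u -> u <= t -> t <= v -> v <= b -> t - d < u -> v < t + d -> P u v) ->
  P a b.
Proof.
move=> ab Pcat Ploc.
pose S := [set x | a <= x <= b /\ P a x].
have Sa : S a.
  split; first by rewrite lexx.
  by have [d d0] := Ploc a (lexx a) ab; apply; rewrite ?gtrBl ?ltrDl.
have supS : has_sup S by split; [exists a|exists b => x [/andP[]]].
have ac : a <= sup S by apply: ub_le_sup => //; case: supS.
have cb : sup S <= b by apply: ge_sup => [|x [/andP[]]]; [exists a|].
have [d d0 Pd] := Ploc _ ac cb.
have [x [/andP[ax xb] Px] cx] := sup_adherent d0 supS.
have xc : x <= sup S by apply: ub_le_sup; [case: supS|split => //; rewrite ax].
(* Overshooting the supremum by half the gauge, capped at b, stays within the reach of [Pd]. Since
   [v] again belongs to [S], this is only possible if the supremum is b. *)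
pose v := Num.min b (sup S + d / 2).
have vb : v <= b by rewrite ge_min lexx.
have cv : sup S <= v by rewrite le_min cb lerDl divr_ge0 ?ltW.
have vd : v < sup S + d.
  by rewrite gt_min ltrD2l ltr_pdivrMr// ltr_pMr// ltr1n orbT.
have Pv : P a v.
  by apply: (Pcat _ x) => //; [exact: le_trans cv|exact: Pd].
have : v <= sup S.
  apply: ub_le_sup; first by case: supS.
  by split => //; rewrite vb andbT (le_trans ac).
rewrite /v ge_min => /orP[bc|]; last by rewrite gerDl leNgt divr_gt0.
suff vE : v = b by rewrite -vE.
by apply/le_anti; rewrite vb le_min lexx (le_trans bc)// lerDl divr_ge0 ?ltW.
Qed.

(** Gaps between successive intervals are allowed, so a chain may keep only the intervals around
    exceptional points, and concatenation follows the additivity required by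
    [interval_induction]. *)
Fixpoint chain (R : realType) (u : R) (s : seq (R * R)) (v : R) : bool :=
  if s is p :: s' then [&& u <= p.1, p.1 <= p.2 & chain p.2 s' v] else u <= v.

Lemma chain_cat (R : realType) (u v w : R) s1 s2 :
  chain u s1 v -> chain v s2 w -> chain u (s1 ++ s2) w.
Proof.
elim: s1 u => [|p s1 IH] u /=; last first.
  by move=> /and3P[-> -> c1] c2; rewrite IH.
case: s2 => [|q s2] /= uv; first exact: le_trans.
by move=> /and3P[vq -> ->]; rewrite (le_trans uv).
Qed.

(* Absolute continuity, with the family of disjoint intervals given as an ordered
   list rather than as a function on an ordinal. *)
Definition ac_on (R : realType) (a b : R) (F : R -> R) : Prop :=
  forall e : R, 0 < e -> exists2 d : R, 0 < d &
    forall s, chain a s b -> \sum_(p <- s) (p.2 - p.1) < d ->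
      \sum_(p <- s) `|F p.2 - F p.1| < e.

Lemma chain_nth (R : realType) (u v : R) s x0 : chain u s v ->
  [/\ u <= v, forall i, (i < size s)%N ->
        u <= (nth x0 s i).1 /\ (nth x0 s i).1 <= (nth x0 s i).2 /\
        (nth x0 s i).2 <= v &
      forall i j, (i < j < size s)%N -> (nth x0 s i).2 <= (nth x0 s j).1].
Proof.
elim: s u => [|p s IH] u /=; first by split => // i j; rewrite ltn0 andbF.
move=> /and3P[up pp /IH[pv Hs Hd]]; split.
- exact/(le_trans up)/(le_trans pp).
- case=> [_|i] /=; first by [].
  rewrite ltnS => /Hs[h1 h2]; split => //.
  exact/(le_trans up)/(le_trans pp).
- case=> [|i] [|j] //=; rewrite ?ltnS; last exact: Hd.
  by move=> /Hs[].
Qed.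

(** The open intervals of a chain are pairwise disjoint, and the increments of F are dominated
    termwise. It is applied with F the real or the imaginary part of f. *)
Lemma abs_continuous_ac_on (R : realType) (a b : R) (f : R -> R[i]) (F : R -> R) :
  (forall x y, `|F y - F x| <= complex.Re `|f y - f x|) ->
  abs_continuous a b f -> ac_on a b F.
Proof.
move=> Ff acf e e0; have [d d0 Hd] := acf e e0; exists d => // s cs sd.
have [ab Hs Hdis] := chain_nth (0, 0) cs.
pose p := fun k : 'I_(size s) => nth (0, 0) s k.
move: sd; rewrite !(big_nth (0, 0)) !big_mkord => sd.
apply: le_lt_trans (Hd _ (fun k => (p k).1) (fun k => (p k).2) _ _ sd).
- by apply: ler_sum => i _; exact: Ff.
- by move=> k; exact: Hs.
- apply/trivIsetP => i j _ _ ij; apply/seteqP; split => // x.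
  rewrite /= !in_itv /= => -[/andP[xi yi] /andP[xj yj]].
  have : (i < j)%N || (j < i)%N by rewrite -neq_ltn.
  case/orP => lt.
    have := Hdis i j; rewrite lt ltn_ord => /(_ isT) le.
    by have := lt_trans yi (le_lt_trans le xj); rewrite ltxx.
  have := Hdis j i; rewrite lt ltn_ord => /(_ isT) le.
  by have := lt_trans yj (le_lt_trans le xi); rewrite ltxx.
Qed.

Lemma is_derive1_approx (R : realType) (f : R -> R) (t l e : R) :
  is_derive t 1 f l -> 0 < e -> exists2 d, 0 < d &
    forall y, `|y - t| < d -> `|f y - f t - l * (y - t)| <= e * `|y - t|.
Proof.
move=> [df fl] e0.
have : (fun h => h^-1 *: (f (h *: 1 + t) - f t)) @ 0^' --> l.
  by rewrite -fl; exact: df.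
move=> /cvgrPdist_le /(_ e e0)[d /= d0 Hd]; exists d => // y yt.
have [->|yNt] := eqVneq y t; first by rewrite !subrr mulr0 subrr normr0 mulr0.
have yt0 : y - t != 0 by rewrite subr_eq0.
have := Hd (y - t); rewrite /= sub0r normrN => /(_ yt yt0).
rewrite [_ *: 1]mulr1 subrK => H.
rewrite -(ler_pdivrMr _ _ _) ?normr_gt0// -normf_div.
apply: le_trans H; rewrite distrC.
have -> : (f y - f t - l * (y - t)) / (y - t) = (y - t)^-1 *: (f y - f t) - l.
  rewrite /GRing.scale /=; field.
  exact: yt0.
by [].
Qed.

(* Outside the exceptional set H has derivative 0 and contributes the term in e;
   near the exceptional points the increments of H are charged to those of F and
   psi2, on intervals whose lengths are controlled by psi1. *)
Lemma chain_estimate (R : realType) (a b e : R) (F H psi1 psi2 : R -> R) :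
  a <= b -> 0 <= e ->
  (forall u v, u <= v -> psi1 u <= psi1 v) ->
  (forall u v, u <= v -> psi2 u <= psi2 v) ->
  (forall t, a <= t -> t <= b -> exists2 d, 0 < d &
     (forall u v, a <= u -> u <= t -> t <= v -> v <= b -> t - d < u -> v < t + d ->
        v - u <= psi1 v - psi1 u /\
        `|H v - H u| <= `|F v - F u| + (psi2 v - psi2 u)) \/
     (forall y, `|y - t| < d -> `|H y - H t| <= e * `|y - t|)) ->
  exists s, [/\ chain a s b,
    \sum_(p <- s) (p.2 - p.1) <= psi1 b - psi1 a &
    `|H b - H a| <= e * (b - a) + \sum_(p <- s) `|F p.2 - F p.1|
      + (psi2 b - psi2 a)].
Proof.
move=> ab e0 psi1_mono psi2_mono Hloc.
pose P u v := exists s, [/\ chain u s v,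
  \sum_(p <- s) (p.2 - p.1) <= psi1 v - psi1 u &
  `|H v - H u| <= e * (v - u) + \sum_(p <- s) `|F p.2 - F p.1|
     + (psi2 v - psi2 u)].
apply: (@interval_induction _ a b P ab) => [u v w _ uv vw _|t at_ tb].
  move=> [s [cs s1 s2]] [s' [cs' s1' s2']].
  exists (s ++ s'); split; first exact: chain_cat cs'.
    by rewrite big_cat /=; lra.
  rewrite big_cat /=.
  have -> : H w - H u = (H v - H u) + (H w - H v) by ring.
  by apply: le_trans (ler_normD _ _) _; lra.
(* In the first case the whole interval from u to v becomes one link of the chain. In the second the
   empty chain suffices, and the increment of H is split at t. *)
have [d d0 [Hd|Hd]] := Hloc t at_ tb; exists d => // u v au ut tv vb du dv.
  have [h1 h2] := Hd u v au ut tv vb du dv.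
  have uv : u <= v by exact: le_trans tv.
  have euv : 0 <= e * (v - u) by rewrite mulr_ge0 ?subr_ge0.
  exists [:: (u, v)]; split => /=; first by rewrite !lexx uv.
    by rewrite big_seq1.
  by rewrite big_seq1 /= -addrA; exact: (ler_wpDl euv).
have uv : u <= v by exact: le_trans tv.
exists [::]; split => //=; first by rewrite big_nil subr_ge0 psi1_mono.
rewrite big_nil addr0; apply: ler_wpDr; first by rewrite subr_ge0 psi2_mono.
have Hv : `|H v - H t| <= e * (v - t).
  by rewrite -[v - t]ger0_norm ?subr_ge0//; apply: Hd; rewrite ger0_norm; lra.
have Hu : `|H u - H t| <= e * (t - u).
  rewrite -[t - u]ger0_norm ?subr_ge0// [`|t - u|]distrC; apply: Hd.
  by rewrite ler0_norm; lra.
have -> : H v - H u = (H v - H t) - (H u - H t) by ring.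
apply: le_trans (ler_normB _ _) _.
have -> : e * (v - u) = e * (v - t) + e * (t - u) by ring.
exact: lerD.
Qed.

Local Notation mu := (@lebesgue_measure _).

Lemma Rintegral_Ny_B (R : realType) (k : R -> R) (u v : R) :
  (@lebesgue_measure R).-integrable setT (EFin \o k) -> u <= v ->
  \int[@lebesgue_measure R]_(t in `]-oo, v]) k t -
  \int[@lebesgue_measure R]_(t in `]-oo, u]) k t =
  \int[@lebesgue_measure R]_(t in `]u, v]) k t.
Proof.
move=> ik uv; rewrite Rintegral_itvB//.
by apply: integrableS ik.
Qed.

Lemma fundamental_theorem_ac (R : realType) (a b : R) (F g : R -> R) :
  a <= b -> ac_on a b F ->
  (@lebesgue_measure R).-integrable `[a, b] (EFin \o g) ->
  {ae @lebesgue_measure R, forall t, t \in `[a, b]%R -> is_derive t 1 F (g t)} ->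
  \int[@lebesgue_measure R]_(t in `[a, b]) g t = F b - F a.
Proof.
move=> ab acF ig aeF.
pose gf := g \_ `[a, b].
have igf : mu.-integrable setT (EFin \o gf).
  by rewrite -restrict_EFin; apply/integrable_restrict => //=; rewrite setTI.
pose G (x : R) := \int[mu]_(t in `]-oo, x]) gf t.
have GB u v : u <= v -> G v - G u = \int[mu]_(t in `]u, v]) gf t.
  exact: Rintegral_Ny_B.
have Gab : G b - G a = \int[mu]_(t in `[a, b]) g t.
  rewrite GB// -Rintegral_itv_obnd_cbnd; last first.
    by apply: integrableS ig => //; exact: subset_itv_oc_cc.
  apply: eq_Rintegral => x; rewrite inE /= => xab.
  by rewrite /gf patchE mem_set//; exact: subset_itv_oc_cc xab.
rewrite -Gab; apply/eqP; rewrite eq_sym -subr_eq0 -normr_le0.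
apply/ler_addgt0Pl => e e0; rewrite addr0.
(* [chain_estimate] will yield e1 times b - a, plus two further terms below e1: the variation of F
   along the chain and the increment of [psi2]. *)
pose e1 := e / (b - a + 2).
have ba2 : 0 < b - a + 2 by rewrite ltr_wpDl// subr_ge0.
have e10 : 0 < e1 by rewrite divr_gt0.
have [d1 d10 Hd1] := acF _ e10.
have [d2 [d20 Hd2]] := integral_normr_continuous igf e10.
have aeG : {ae mu, forall x, derivable G x 1 /\ G^`()%classic x = gf x}.
  apply: FTC1Ny; first by move=> y; apply: integrableS igf.
  exact: open_integrable_locally openT igf.
have [N [mN N0 HN]] : {ae mu, forall t, t \in `[a, b]%R ->
    is_derive t 1 F (g t) /\ (derivable G t 1 /\ G^`()%classic t = gf t)}.
  move: aeF aeG; apply: (@filterS2 _ _ (ae_filter_ringOfSetsType _)).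
  by move=> t H1 H2 tab; split => //; exact: H1.
(* The open set enclosing the null set [N] must be smaller than [d1], to control the variation of F
   over it, and than [d2], to control the integral of |gf| over it. *)
have d0 : 0 < Num.min d1 d2 by rewrite lt_min d10.
have [|O [oO NO muO]] := lebesgue_regularity_outer mN _ d0.
  by rewrite [ltLHS]N0 ltry.
have mO : measurable O by exact: open_measurable.
have Od : (mu O < (Num.min d1 d2)%:E)%E.
  have -> : O = (O `\` N) `|` N by rewrite setUC setDUK.
  apply: le_lt_trans (measureU2 _ _ _) _ => //; first exact: measurableD.
  by rewrite [X in (_ + X)%E]N0 adde0.
(* With this cut, the increments of [psi1] and [psi2] from a to b are exactly the measure of [O']
   and the integral of |gf| over it. *)
pose O' := O `&` `]a, b].
have mO' : measurable O' by exact: measurableI.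
have O'd : (mu O' < (Num.min d1 d2)%:E)%E.
  by apply: le_lt_trans Od; apply: le_measure; rewrite ?inE//; exact: subIsetl.
pose k1 : R -> R := (fun=> 1 : R) \_ O'.
have ik1 : mu.-integrable setT (EFin \o k1).
  rewrite -restrict_EFin; apply/integrable_restrict => //=; rewrite setTI.
  apply: measurable_bounded_integrable => //; first exact: lt_trans O'd (ltry _).
  exact: bounded_cst.
pose k2 := (fun t => `|gf t|) \_ O'.
have ik2 : mu.-integrable setT (EFin \o k2).
  rewrite -restrict_EFin; apply/integrable_restrict => //=; rewrite setTI.
  by apply: integrableS (integrable_norm igf).
pose psi1 (x : R) := \int[mu]_(t in `]-oo, x]) k1 t.
pose psi2 (x : R) := \int[mu]_(t in `]-oo, x]) k2 t.
have p1B u v : u <= v -> psi1 v - psi1 u = \int[mu]_(t in `]u, v]) k1 t.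
  exact: Rintegral_Ny_B.
have p2B u v : u <= v -> psi2 v - psi2 u = \int[mu]_(t in `]u, v]) k2 t.
  exact: Rintegral_Ny_B.
have p1d : psi1 b - psi1 a < d1.
  rewrite p1B// -Rintegral_mkcondr Rintegral_cst ?mul1r; last exact: measurableI.
  rewrite setIC -setIA setIid; move: (O'd); rewrite -/O'.
  rewrite -[X in (X < _)%E]fineK ?ge0_fin_numE//; last exact: lt_trans O'd (ltry _).
  by rewrite lte_fin lt_min => /andP[].
have p2d : psi2 b - psi2 a < e1.
  rewrite p2B// -Rintegral_mkcondr setIC -setIA setIid -/O'.
  apply: Hd2 => //; apply: lt_le_trans O'd _.
  by rewrite lee_fin ge_min lexx orbT.
have p1ge u v : u <= v -> 0 <= psi1 v - psi1 u.
  move=> uv; rewrite p1B//; apply: Rintegral_ge0 => x _.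
  by rewrite /k1 patchE; case: ifP.
have p2ge u v : u <= v -> 0 <= psi2 v - psi2 u.
  move=> uv; rewrite p2B//; apply: Rintegral_ge0 => x _.
  by rewrite /k2 patchE; case: ifP.
have [||t at_ tb|s [cs s1 s2]] :=
    @chain_estimate _ a b e1 F (F \- G) psi1 psi2 ab (ltW e10).
- by move=> u v uv; rewrite -subr_ge0 p1ge.
- by move=> u v uv; rewrite -subr_ge0 p2ge.
(* Near an exceptional point the interval lies in [O], so its length is charged to [psi1] and the
   increment of G to [psi2]. At any other point F - G has derivative 0. *)
- have [tN|tN] := pselect (N t).
    have [d /= dpos dO] : nbhs t O by apply: open_nbhs_nbhs; split => //; exact: NO.
    exists d => //; left => u v au ut tv vb du dv.
    have uv : u <= v by exact: le_trans tv.
    have uvO : `]u, v] `<=` O'.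
      move=> x /=; rewrite in_itv/= => /andP[ux xv]; split.
        by apply: dO; rewrite /= ltr_norml; clear -ux xv du dv; apply/andP; split; lra.
      by rewrite /= in_itv /= (le_lt_trans au ux) (le_trans xv vb).
    split.
      rewrite p1B// -Rintegral_mkcondr setIidl// Rintegral_cst// mul1r.
      rewrite [X in fine X]lebesgue_measure_itv /= lte_fin.
      by case: ltP => //= vu; rewrite subr_le0.
    have -> : (F \- G) v - (F \- G) u = (F v - F u) - (G v - G u) by rewrite /=; ring.
    apply: le_trans (ler_normB _ _) _; rewrite lerD2l GB// p2B//.
    rewrite [leRHS](_ : _ = \int[mu]_(t in `]u, v]) `|gf t|); last first.
      by rewrite -Rintegral_mkcondr setIidl.
    apply: le_normr_Rintegral => //.
    by apply: integrableS igf.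
  have tab : t \in `[a, b]%R by rewrite in_itv /= at_ tb.
  have [dF [dG Gt]] : is_derive t 1 F (g t) /\
      (derivable G t 1 /\ G^`()%classic t = gf t).
    by apply: contrapT => bad; apply: tN; apply: HN => /(_ tab).
  have dGt : is_derive t 1 G (g t).
    by split => //; rewrite -derive1E Gt /gf patchE mem_set.
  have [d dpos Hd] := is_derive1_approx (is_deriveB dF dGt) e10.
  exists d => //; right => y /Hd; rewrite subrr mul0r subr0 /=.
  by congr (`|_| <= _); rewrite /=; ring.
have -> : F b - F a - (G b - G a) = (F \- G) b - (F \- G) a by rewrite /=; ring.
have sF : \sum_(p <- s) `|F p.2 - F p.1| < e1.
  by apply: Hd1 => //; exact: le_lt_trans p1d.
have eE : e1 * (b - a + 2) = e by rewrite /e1 divfK// gt_eqF.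
apply: le_trans s2 _; rewrite -eE.
clear -sF p2d.
by lra.
Qed.

(** * Trigonometric multipliers *)

Lemma chain_mem (R : realType) (u v : R) s p : chain u s v -> p \in s ->
  [/\ u <= p.1, p.1 <= p.2 & p.2 <= v].
Proof.
move=> cs /(nthP (0, 0))[i si <-].
elim: s u cs i si => //= q s IH u /and3P[uq qq cs] [|i] /= si.
  by split => //; have [] := chain_nth (0, 0) cs.
have [h1 h2 h3] := IH _ cs i si; split => //.
exact/(le_trans uq)/(le_trans qq).
Qed.

(** Boundedness passes to the union of two adjacent intervals, and near any point a chain with a
    single link shows that F varies by less than 1. *)
Lemma ac_on_bounded (R : realType) (a b : R) (F : R -> R) :
  a <= b -> ac_on a b F ->
  exists2 M, 0 <= M & forall x, a <= x <= b -> `|F x| <= M.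
Proof.
move=> ab acF; have [d d0 Hd] := acF 1 ltr01.
pose P u v := exists2 M, 0 <= M & forall x : R, u <= x <= v -> `|F x| <= M.
apply: (@interval_induction _ a b P ab) => [u v w _ _ _ _ [M M0 HM] [N N0 HN]|t at_ tb].
  exists (M + N); first exact: addr_ge0.
  move=> x /andP[ux xw]; have [xv|vx] := leP x v.
    by rewrite ler_wpDr// HM// ux.
  by rewrite ler_wpDl// HN// ltW.
exists d => // u v au ut tv vb du dv.
exists (`|F t| + 1) => [|x /andP[ux xv]]; first by rewrite addr_ge0.
rewrite -lerBlDl (le_trans (lerB_dist _ _))// ltW//.
have [xt|tx] := leP x t.
  have := Hd [:: (x, t)]; rewrite !big_seq1 /= distrC; apply.
    by rewrite (le_trans au)// xt.
  lra.
have := Hd [:: (t, x)]; rewrite !big_seq1 /=; apply.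
  by rewrite at_ (ltW tx) (le_trans xv).
lra.
Qed.

Lemma ac_onD (R : realType) (a b : R) (F G : R -> R) :
  ac_on a b F -> ac_on a b G -> ac_on a b (F \+ G).
Proof.
move=> acF acG e e0; have e20 : 0 < e / 2 by rewrite divr_gt0.
have [d1 d10 H1] := acF _ e20; have [d2 d20 H2] := acG _ e20.
exists (Num.min d1 d2); first by rewrite lt_min d10.
move=> s cs; rewrite lt_min => /andP[/(H1 _ cs) h1 /(H2 _ cs) h2].
rewrite [e]splitr; apply: le_lt_trans (ltrD h1 h2).
rewrite -big_split /=; apply: ler_sum => p _.
by rewrite opprD addrACA ler_normD.
Qed.

Lemma ac_onB (R : realType) (a b : R) (F G : R -> R) :
  ac_on a b F -> ac_on a b G -> ac_on a b (F \- G).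
Proof.
move=> acF acG e e0; have e20 : 0 < e / 2 by rewrite divr_gt0.
have [d1 d10 H1] := acF _ e20; have [d2 d20 H2] := acG _ e20.
exists (Num.min d1 d2); first by rewrite lt_min d10.
move=> s cs; rewrite lt_min => /andP[/(H1 _ cs) h1 /(H2 _ cs) h2].
rewrite [e]splitr; apply: le_lt_trans (ltrD h1 h2).
rewrite -big_split /=; apply: ler_sum => p _.
have -> : F p.2 - G p.2 - (F p.1 - G p.1) = (F p.2 - F p.1) - (G p.2 - G p.1).
  ring.
exact: ler_normB.
Qed.

(** An increment of E F splits as E(y) (F(y) - F(x)) + (E(y) - E(x)) F(x). The bound on E handles
    the first term; the Lipschitz constant together with a bound on F handles the second. *)
Lemma ac_onM (R : realType) (a b K L : R) (E F : R -> R) : a <= b ->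
  (forall x, `|E x| <= K) -> (forall x y, `|E y - E x| <= L * `|y - x|) ->
  ac_on a b F -> ac_on a b (fun x => E x * F x).
Proof.
move=> ab EK EL acF e e0; have [M M0 FM] := ac_on_bounded ab acF.
have K0 : 0 <= K by exact: le_trans (EK 0).
have L0 : 0 <= L.
  by have := EL 0 1; rewrite subr0 normr1 mulr1; apply: le_trans.
(* Adding 1 here and to K keeps the divisors positive even when the constants vanish. *)
have ML0 : 0 < M * L + 1 by rewrite ltr_wpDl// mulr_ge0.
have K1 : 0 < K + 1 by rewrite ltr_wpDl.
have eK0 : 0 < e / 2 / (K + 1) by rewrite !divr_gt0.
have [d1 d10 H1] := acF _ eK0.
pose d2 := e / 2 / (M * L + 1).
have d20 : 0 < d2 by rewrite !divr_gt0.
exists (Num.min d1 d2); first by rewrite lt_min d10.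
move=> s cs; rewrite lt_min => /andP[/(H1 _ cs) h1 h2].
apply: (@le_lt_trans _ _ ((K + 1) * \sum_(p <- s) `|F p.2 - F p.1| +
   (M * L + 1) * \sum_(p <- s) (p.2 - p.1))).
  rewrite !mulr_sumr -big_split /= big_seq [leRHS]big_seq.
  apply: ler_sum => p ps; have [h3 h4 h5] := chain_mem cs ps.
  have -> : E p.2 * F p.2 - E p.1 * F p.1 =
    E p.2 * (F p.2 - F p.1) + (E p.2 - E p.1) * F p.1 by ring.
  apply: le_trans (ler_normD _ _) _; rewrite !normrM; apply: lerD.
    by apply: ler_wpM2r => //; rewrite ler_wpDr.
  have := EL p.1 p.2; rewrite [`|p.2 - p.1|]ger0_norm ?subr_ge0// => h6.
  apply: (@le_trans _ _ (L * (p.2 - p.1) * M)).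
    by apply: ler_pM => //; apply: FM; rewrite h3 (le_trans h4).
  have : 0 <= p.2 - p.1 by rewrite subr_ge0.
  by move: (p.2 - p.1) => x x0; clear -x0; lra.
rewrite [e]splitr; apply: ltrD.
  by rewrite mulrC -ltr_pdivlMr.
by rewrite mulrC -ltr_pdivlMr.
Qed.

Lemma lipschitz_of_derive (R : realType) (f df : R -> R) (L : R) :
  (forall x : R, is_derive x 1 f (df x)) -> (forall x, `|df x| <= L) ->
  forall x y, `|f y - f x| <= L * `|y - x|.
Proof.
move=> fdf dfL.
have le_case x y : x <= y -> `|f y - f x| <= L * `|y - x|.
  move=> xy; have [|c _ ->] := @MVT_segment _ f df x y xy (fun x _ => fdf x).
    apply: derivable_within_continuous => z _; exact: ex_derive.
  by rewrite normrM ler_wpM2r.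
move=> x y; have [|/ltW] := leP x y; first exact: le_case.
by rewrite distrC [`|y - x|]distrC; exact: le_case.
Qed.

Lemma is_derive_cos_lin (R : realType) (c t : R) :
  is_derive t 1 (fun s => cos (c * s)) (- (c * sin (c * t))).
Proof.
have h : is_derive t 1 (fun s : R => c * s) c.
  by apply: is_derive_eq; rewrite [_ *: 1]mulr1.
have := @is_derive1_comp _ cos (fun s => c * s) t _ _ (is_derive_cos _) h.
by move=> H; apply: is_derive_eq H _; rewrite mulNr mulrC.
Qed.

Lemma is_derive_sin_lin (R : realType) (c t : R) :
  is_derive t 1 (fun s => sin (c * s)) (c * cos (c * t)).
Proof.
have h : is_derive t 1 (fun s : R => c * s) c.
  by apply: is_derive_eq; rewrite [_ *: 1]mulr1.
have := @is_derive1_comp _ sin (fun s => c * s) t _ _ (is_derive_sin _) h.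
by move=> H; apply: is_derive_eq H _; rewrite mulrC.
Qed.

Lemma cos_lin_lipschitz (R : realType) (c x y : R) :
  `|cos (c * y) - cos (c * x)| <= `|c| * `|y - x|.
Proof.
apply: (@lipschitz_of_derive _ (fun t => cos (c * t)) (fun t => - (c * sin (c * t)))).
  by move=> t; exact: is_derive_cos_lin.
by move=> t; rewrite normrN normrM ler_piMr// ler_norml sin_geN1 sin_le1.
Qed.

Lemma sin_lin_lipschitz (R : realType) (c x y : R) :
  `|sin (c * y) - sin (c * x)| <= `|c| * `|y - x|.
Proof.
apply: (@lipschitz_of_derive _ (fun t => sin (c * t)) (fun t => c * cos (c * t))).
  by move=> t; exact: is_derive_sin_lin.
by move=> t; rewrite normrM ler_piMr// ler_norml cos_geN1 cos_le1.
Qed.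

Lemma expiD (R : realType) (s t : R) : expi (s + t) = expi s * expi t.
Proof. by rewrite /expi cosD sinD; congr (_ +i* _)%C; rewrite addrC. Qed.

Lemma expi0 (R : realType) : expi 0 = 1 :> R[i].
Proof. by rewrite /expi cos0 sin0. Qed.

Lemma expi_conj (R : realType) (t : R) : (expi t)^* = expi (- t).
Proof. by rewrite /expi cosN sinN. Qed.

Lemma expiX (R : realType) (t : R) n : expi t ^+ n = expi (n%:R * t).
Proof.
elim: n => [|n IH]; first by rewrite mul0r expi0.
by rewrite exprS IH -expiD -natr1 mulrDl mul1r addrC.
Qed.

Lemma expi_2pi_int (R : realType) (m : int) : expi (m%:~R * (2 * pi)) = 1 :> R[i].
Proof.
have h n : expi (n%:R * (2 * pi)) = 1 :> R[i].
  by rewrite -expiX /expi mulr_natl cos2pi sin2pi expr1n.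
case: m => n; first exact: h.
by rewrite NegzE mulrNz mulNr -expi_conj h rmorph1.
Qed.

(** * Complex integrals and moments *)

Lemma cReM (R : realType) (x y : R[i]) :
  complex.Re (x * y) = complex.Re x * complex.Re y - complex.Im x * complex.Im y.
Proof. by case: x y => a b [c d]. Qed.

Lemma cImM (R : realType) (x y : R[i]) :
  complex.Im (x * y) = complex.Re x * complex.Im y + complex.Im x * complex.Re y.
Proof. by case: x y => a b [c d] /=; ring. Qed.

Lemma cReD (R : realType) (x y : R[i]) :
  complex.Re (x + y) = complex.Re x + complex.Re y.
Proof. by case: x y => a b [c d]. Qed.

Lemma cImD (R : realType) (x y : R[i]) :
  complex.Im (x + y) = complex.Im x + complex.Im y.
Proof. by case: x y => a b [c d]. Qed.

Lemma complexP (R : realType) (x y : R[i]) :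
  complex.Re x = complex.Re y -> complex.Im x = complex.Im y -> x = y.
Proof. by case: x y => a b [c d] /= -> ->. Qed.

Lemma normC_Re_le (R : realType) (x y : R[i]) :
  `|complex.Re y - complex.Re x| <= complex.Re `|y - x|.
Proof.
rewrite normc_def /=; case: x y => a b [c d] /=.
by rewrite -sqrtr_sqr; apply: ler_wsqrtr; rewrite lerDl sqr_ge0.
Qed.

Lemma normC_Im_le (R : realType) (x y : R[i]) :
  `|complex.Im y - complex.Im x| <= complex.Re `|y - x|.
Proof.
rewrite normc_def /=; case: x y => a b [c d] /=.
by rewrite -sqrtr_sqr; apply: ler_wsqrtr; rewrite lerDr sqr_ge0.
Qed.

Section ComplexIntegral.
Variables (R : realType) (D : set R).
Hypothesis mD : measurable (D : set (measurableTypeR R)).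
Local Notation mu := (@lebesgue_measure R).

Definition cintegrable (f : R -> R[i]) :=
  mu.-integrable D (EFin \o (fun t => complex.Re (f t))) /\
  mu.-integrable D (EFin \o (fun t => complex.Im (f t))).

Lemma integrable_linear (f g : R -> R) (a b : R) :
  mu.-integrable D (EFin \o f) -> mu.-integrable D (EFin \o g) ->
  mu.-integrable D (EFin \o (fun t => a * f t + b * g t)).
Proof.
move=> fi gi.
have := integrableD mD (integrableZl mD a fi) (integrableZl mD b gi).
by apply: eq_integrable.
Qed.

Lemma Rintegral_linear (f g : R -> R) (a b : R) :
  mu.-integrable D (EFin \o f) -> mu.-integrable D (EFin \o g) ->
  \int[mu]_(t in D) (a * f t + b * g t) =
  a * \int[mu]_(t in D) f t + b * \int[mu]_(t in D) g t.
Proof.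
move=> fi gi; rewrite RintegralD ?RintegralZl//.
  by have := integrableZl mD a fi; apply: eq_integrable.
by have := integrableZl mD b gi; apply: eq_integrable.
Qed.

Lemma cintegrableD f g : cintegrable f -> cintegrable g ->
  cintegrable (fun t => f t + g t).
Proof.
move=> [f1 f2] [g1 g2]; split.
  by have := integrable_linear 1 1 f1 g1; apply: eq_integrable => // x _ /=;
    rewrite cReD !mul1r.
by have := integrable_linear 1 1 f2 g2; apply: eq_integrable => // x _ /=;
  rewrite cImD !mul1r.
Qed.

Lemma cintegralD f g : cintegrable f -> cintegrable g ->
  cintegral D (fun t => f t + g t) = cintegral D f + cintegral D g.
Proof.
move=> [f1 f2] [g1 g2]; apply: complexP; rewrite ?cReD ?cImD /cintegral /=.
  by rewrite -RintegralD//; apply: eq_Rintegral => x _; rewrite cReD.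
by rewrite -RintegralD//; apply: eq_Rintegral => x _; rewrite cImD.
Qed.

Lemma cintegrableZ c f : cintegrable f -> cintegrable (fun t => c * f t).
Proof.
case: c => a b [f1 f2]; split.
  have := integrable_linear a (- b) f1 f2; apply: eq_integrable => // x _ /=.
  by rewrite cReM /= mulNr.
have := integrable_linear a b f2 f1; apply: eq_integrable => // x _ /=.
by rewrite cImM.
Qed.

Lemma cintegralZ c f : cintegrable f ->
  cintegral D (fun t => c * f t) = c * cintegral D f.
Proof.
case: c => a b [f1 f2]; apply: complexP; rewrite ?cReM ?cImM /cintegral /=.
  rewrite -mulNr -Rintegral_linear//; apply: eq_Rintegral => x _.
  by rewrite cReM /= mulNr.
by rewrite -Rintegral_linear//; apply: eq_Rintegral => x _; rewrite cImM.
Qed.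

Lemma cintegral_conj f : cintegrable f ->
  cintegral D (fun t => (f t)^*) = (cintegral D f)^*.
Proof.
move=> [f1 f2]; apply: complexP => /=.
  by apply: eq_Rintegral => x _; case: (f x).
rewrite -mulN1r -RintegralZl//; apply: eq_Rintegral => x _.
by rewrite mulN1r; case: (f x).
Qed.

Lemma eq_cintegral f g : (forall t, f t = g t) -> cintegral D f = cintegral D g.
Proof. by move=> fg; congr cintegral; exact/funext. Qed.

Lemma cintegrable0 : cintegrable (fun=> 0).
Proof. by split; exact: integrable0. Qed.

Lemma cintegral0 : cintegral D (fun=> 0) = 0.
Proof. by apply: complexP; rewrite /= Rintegral_cst// mul0r. Qed.

Lemma cintegrable_sum (I : Type) (s : seq I) (f : I -> R -> R[i]) :
  (forall j, cintegrable (f j)) -> cintegrable (fun t => \sum_(j <- s) f j t).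
Proof.
move=> fi; elim: s => [|j s IH].
  by rewrite (_ : (fun=> _) = fun=> 0); [exact: cintegrable0|
    apply/funext => t; rewrite big_nil].
rewrite (_ : (fun=> _) = fun t => f j t + \sum_(j <- s) f j t).
  exact: cintegrableD.
by apply/funext => t; rewrite big_cons.
Qed.

Lemma cintegral_sum (I : Type) (s : seq I) (f : I -> R -> R[i]) :
  (forall j, cintegrable (f j)) ->
  cintegral D (fun t => \sum_(j <- s) f j t) = \sum_(j <- s) cintegral D (f j).
Proof.
move=> fi; elim: s => [|j s IH].
  by rewrite big_nil -[RHS]cintegral0; apply: eq_cintegral => t; rewrite big_nil.
rewrite big_cons -IH -cintegralD//; last exact: cintegrable_sum.
by apply: eq_cintegral => t; rewrite big_cons.
Qed.

Lemma bounded_continuous_integrable (h w : R -> R) (M : R) :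
  mu.-integrable D (EFin \o w) -> continuous h -> (forall t, `|h t| <= M) ->
  mu.-integrable D (EFin \o (fun t => h t * w t)).
Proof.
move=> iw ch hM.
have bh : [bounded h x | x in D].
  exists M; split; rewrite ?num_real// => x Mx y _ /=.
  exact: le_trans (hM y) (ltW Mx).
have mh : measurable_fun D h.
  exact: measurable_funTS (continuous_measurable_fun ch).
by have := integrableMl mD iw mh bh; apply: eq_integrable => // t _;
  rewrite /= mulrC EFinM.
Qed.

Lemma cintegrable_expi (w : R -> R) (c : R) : mu.-integrable D (EFin \o w) ->
  cintegrable (fun t => expi (c * t) * (w t)%:C%C).
Proof.
move=> iw; have lin : continuous (fun t : R => c * t).
  by move=> t; apply: cvgM; [exact: cvg_cst|exact: cvg_id].
split.
  have : mu.-integrable D (EFin \o (fun t => cos (c * t) * w t)).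
    apply: (@bounded_continuous_integrable _ _ 1) => // t.
      by apply: continuous_comp; [exact: lin|exact: continuous_cos].
    by rewrite ler_norml cos_geN1 cos_le1.
  by apply: eq_integrable => // t _; rewrite /= mulr0 subr0.
have : mu.-integrable D (EFin \o (fun t => sin (c * t) * w t)).
  apply: (@bounded_continuous_integrable _ _ 1) => // t.
    by apply: continuous_comp; [exact: lin|exact: continuous_sin].
  by rewrite ler_norml sin_geN1 sin_le1.
by apply: eq_integrable => // t _; rewrite /= mulr0 add0r.
Qed.

End ComplexIntegral.

Lemma conjCM (C : numClosedFieldType) (x y : C) : (x * y)^* = x^* * y^*.
Proof. exact: rmorphM. Qed.

Lemma conjC_sum (C : numClosedFieldType) (I : Type) (s : seq I) (F : I -> C) :
  (\sum_(j <- s) F j)^* = \sum_(j <- s) (F j)^*.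
Proof. exact: rmorph_sum. Qed.

(** The sign of the exponent makes the inner product of z^j and z^k the moment of index j - k. *)
Definition moment (R : realType) (w : R -> R) (m : int) : R[i] :=
  cintegral `[0, 2 * pi] (fun t => expi (m%:~R * t) * (w t)%:C%C).

Section Moments.
Variables (R : realType) (w : R -> R).
Hypothesis hw : positive_weight w.
Local Notation D := (`[0, 2 * pi]%classic : set (measurableTypeR R)).
Local Notation mu := (@lebesgue_measure R).

Let mD : measurable D.
Proof. exact: measurable_itv. Qed.

Let iw : mu.-integrable D (EFin \o w).
Proof. by case: hw. Qed.

Lemma momentN (m : int) : moment w (- m) = (moment w m)^*.
Proof.
rewrite /moment -cintegral_conj//; last exact: cintegrable_expi.
apply: eq_cintegral => t; rewrite conjCM expi_conj -mulNr mulrNz.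
by congr (_ * _); apply: complexP => //=; rewrite oppr0.
Qed.

Lemma horner_expi (p : {poly R[i]}) (t : R) n : (size p <= n)%N ->
  p.[expi t] = \sum_(j < n) p`_j * expi (j%:R * t).
Proof.
by move=> sp; rewrite (horner_coef_wide _ sp); apply: eq_bigr => j _; rewrite expiX.
Qed.

Lemma inner_integrandE (p q : {poly R[i]}) (t : R) :
  p.[expi t] * (q.[expi t])^* * (w t)%:C%C =
  \sum_(k < size q) (q`_k)^* *
    \sum_(j < size p) p`_j * (expi ((j%:Z - k%:Z)%:~R * t) * (w t)%:C%C).
Proof.
rewrite (horner_expi _ (leqnn _)) [q.[_]](horner_expi _ (leqnn _)) conjC_sum.
rewrite mulr_sumr mulr_suml; apply: eq_bigr => k _.
rewrite mulr_suml mulr_suml mulr_sumr; apply: eq_bigr => j _.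
rewrite conjCM expi_conj.
have -> : (j%:Z - k%:Z)%:~R * t = j%:R * t + - (k%:R * t).
  by rewrite intrD mulrNz mulrDl mulNr.
by rewrite expiD; ring.
Qed.

Lemma cintegrable_laurent (p : {poly R[i]}) (k : nat) :
  cintegrable D (fun t => \sum_(j < size p) p`_j *
    (expi ((j%:Z - k%:Z)%:~R * t) * (w t)%:C%C)).
Proof.
apply: cintegrable_sum => // j; apply: cintegrableZ => //.
exact: cintegrable_expi.
Qed.

Lemma cintegrable_inner (p q : {poly R[i]}) :
  cintegrable D (fun t => p.[expi t] * (q.[expi t])^* * (w t)%:C%C).
Proof.
rewrite (funext (inner_integrandE p q)); apply: cintegrable_sum => // k.
by apply: cintegrableZ => //; exact: cintegrable_laurent.
Qed.

(** This turns the inner product into a Toeplitz form in the moments, so that the study of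
    orthogonality becomes purely algebraic. *)
Lemma inner_moment (p q : {poly R[i]}) :
  inner w (horner p) (horner q) =
  \sum_(k < size q) (q`_k)^* * \sum_(j < size p) p`_j * moment w (j%:Z - k%:Z).
Proof.
rewrite /inner (eq_cintegral _ (inner_integrandE p q)) cintegral_sum//; last first.
  by move=> k; apply: cintegrableZ => //; exact: cintegrable_laurent.
apply: eq_bigr => k _; rewrite cintegralZ//; last exact: cintegrable_laurent.
congr (_ * _); rewrite cintegral_sum//; last first.
  by move=> j; apply: cintegrableZ => //; exact: cintegrable_expi.
by apply: eq_bigr => j _; rewrite cintegralZ//; exact: cintegrable_expi.
Qed.

(** On the half period [0, pi] the cosine is injective, so each element r of the list is reached at
    most at acos(Re r). *)
Lemma negligible_expi (rs : seq R[i]) :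
  mu.-negligible [set t | t \in `[0, pi]%R /\ expi t \in rs].
Proof.
elim: rs => [|r rs IH].
  by apply: negligibleS (negligible_set0 _) => t [].
have h1 : mu.-negligible [set acos (complex.Re r)].
  by apply/negligibleP => //; exact: lebesgue_measure_set1.
apply: negligibleS (negligibleU h1 IH) => t /= [t0].
rewrite inE => /orP[/eqP <-|tr]; [left|by right].
by rewrite /= cosK.
Qed.

(** The nonnegative function |p|^2 w has integral 0, hence vanishes almost everywhere; as w is
    positive almost everywhere, so does p on the circle. A nonzero p has finitely many roots, which
    would make [0, pi] a null set. *)
Lemma inner_definite (p : {poly R[i]}) :
  inner w (horner p) (horner p) = 0 -> p = 0.
Proof.
move=> h0; apply: contrapT => /eqP p0.
pose h t := complex.Re p.[expi t] ^+ 2 + complex.Im p.[expi t] ^+ 2.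
have [rs prs] := closed_field_poly_normal p.
have h_rs t : h t = 0 -> expi t \in rs.
  move=> ht; rewrite -root_prod_XsubC.
  have : root p (expi t).
    apply/rootP; apply: complexP => /=; apply/eqP; rewrite -(sqrf_eq0 (_ : R)).
      by have := ht; move/eqP; rewrite paddr_eq0 ?sqr_ge0// => /andP[].
    by have := ht; move/eqP; rewrite paddr_eq0 ?sqr_ge0// => /andP[].
  by rewrite prs rootZ ?lead_coef_eq0.
have hh t : p.[expi t] * (p.[expi t])^* * (w t)%:C%C = (h t * w t)%:C%C.
  rewrite /h; case: (p.[expi t]) => a b; apply: complexP => /=; ring.
have ihw : mu.-integrable D (EFin \o (fun t => h t * w t)).
  have [+ _] := cintegrable_inner p p; apply: eq_integrable => // t _.
  exact: (congr1 (fun z => (complex.Re z)%:E) (hh t)).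
have ih0 : (\int[mu]_(t in D) (h t * w t)%:E)%E = 0%E.
  rewrite -[LHS]fineK ?integrable_fin_num//; congr EFin.
  transitivity (complex.Re (inner w (horner p) (horner p))); last by rewrite h0.
  rewrite /inner /cintegral /= -/(Rintegral _ _ _).
  by apply: eq_Rintegral => t _; exact: esym (congr1 (@complex.Re R) (hh t)).
have [_ aew] := hw.
have mhw : measurable_fun D (EFin \o (fun t => h t * w t)).
  exact: measurable_int ihw.
have : (\int[mu]_(t in D) `|(EFin \o (fun t => h t * w t)%R) t|)%E = 0.
  rewrite -[RHS]ih0; apply: ae_eq_integral => //.
    exact: measurableT_comp.
  move: aew; apply: (@filterS _ _ (ae_filter_ringOfSetsType mu)) => t wt tD.
  rewrite /= ger0_norm// mulr_ge0 ?addr_ge0 ?sqr_ge0//.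
  by apply/ltW/wt.
move/(ae_eq_integral_abs _ mD mhw) => aeh.
have : mu.-negligible `[0, pi].
  have h1 : {ae mu, forall t, t \in `[0, pi]%R -> expi t \in rs}.
    move: aeh aew; apply: (@filterS2 _ _ (ae_filter_ringOfSetsType mu)).
    move=> t h1 h2 tpi; apply: h_rs.
    have tD : t \in `[0, 2 * pi]%R.
      move: tpi; rewrite !in_itv/= => /andP[-> /=] /le_trans; apply.
      by rewrite ler_peMl ?pi_ge0// ler1n.
    have /= [/eqP] := h1 tD.
    by rewrite mulf_eq0 (gt_eqF (h2 tD)) orbF => /eqP.
  apply: negligibleS (negligibleU h1 (negligible_expi rs)) => t tpi.
  have [tr|tr] := boolP (expi t \in rs); first by right.
  by left => /= /(_ tpi); apply/negP.
move/negligibleP => /(_ (measurable_itv _)).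
rewrite /= lebesgue_measure_itv /= lte_fin pi_gt0 sube0 => -[] /eqP.
by rewrite gt_eqF// pi_gt0.
Qed.

Lemma pearson_moment (A B : {poly R[i]}) (m : int) :
  (size A <= 4)%N -> (size B <= 4)%N -> pearson A B w ->
  A.[1] * (w (2 * pi) - w 0)%:C%C = 0 ->
  \sum_(j < 4) ('i * m%:~R * A`_j + B`_j) * moment w (m + j%:Z) = 0.
Proof.
move=> sA sB [acF aeF] bd.
set F := (fun t => A.[expi t] * (w t)%:C%C) in acF aeF.
pose G t := B.[expi t] * (w t)%:C%C.
pose E t : R[i] := expi (m%:~R * t).
(* By the product rule and the Pearson equation this is almost everywhere the derivative of E F. *)
pose g t := 'i * m%:~R * E t * F t + E t * G t.
have gE t : g t = \sum_(j < 4) ('i * m%:~R * A`_j + B`_j) *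
    (expi ((m + j%:Z)%:~R * t) * (w t)%:C%C).
  rewrite /g /F /G (horner_expi _ sA) (horner_expi _ sB) !mulr_suml !mulr_sumr.
  rewrite -big_split; apply: eq_bigr => j _ /=.
  have -> : (m + j%:Z)%:~R * t = m%:~R * t + j%:R * t by rewrite intrD mulrDl.
  by rewrite expiD -/(E t); ring.
have ig : cintegrable D g.
  rewrite (_ : g = fun t => \sum_(j < 4) ('i * m%:~R * A`_j + B`_j) *
    (expi ((m + j%:Z)%:~R * t) * (w t)%:C%C)); last exact/funext.
  apply: cintegrable_sum => // j; apply: cintegrableZ => //.
  exact: cintegrable_expi.
transitivity (cintegral D g).
  rewrite (eq_cintegral _ gE) cintegral_sum//; last first.
    by move=> j; apply: cintegrableZ => //; exact: cintegrable_expi.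
  by apply: eq_bigr => j _; rewrite cintegralZ//; exact: cintegrable_expi.
have pi20 : 0 <= 2 * pi :> R by rewrite mulr_ge0 ?pi_ge0.
(* Both endpoints correspond to z = 1, so this is the boundary hypothesis. *)
have F2pi : F (2 * pi) = F 0.
  rewrite /F expi0 -[2 * pi]mul1r (expi_2pi_int R 1) mul1r.
  by apply/eqP; rewrite -subr_eq0 -mulrBr -rmorphB bd.
have acRe := abs_continuous_ac_on (fun x y => normC_Re_le (F x) (F y)) acF.
have acIm := abs_continuous_ac_on (fun x y => normC_Im_le (F x) (F y)) acF.
pose c : R := m%:~R.
have cE : m%:~R = c%:C%C :> R[i] by rewrite rmorph_int.
have cosM (H : R -> R) : ac_on 0 (2 * pi) H ->
    ac_on 0 (2 * pi) (fun x => cos (c * x) * H x).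
  apply: (@ac_onM _ _ _ 1 `|c|) => // [x|x y].
    by rewrite ler_norml cos_geN1 cos_le1.
  exact: cos_lin_lipschitz.
have sinM (H : R -> R) : ac_on 0 (2 * pi) H ->
    ac_on 0 (2 * pi) (fun x => sin (c * x) * H x).
  apply: (@ac_onM _ _ _ 1 `|c|) => // [x|x y].
    by rewrite ler_norml sin_geN1 sin_le1.
  exact: sin_lin_lipschitz.
have c2pi := expi_2pi_int R m.
have /(congr1 (@complex.Re R)) /= cos2 := c2pi.
have /(congr1 (@complex.Im R)) /= sin2 := c2pi.
have gRe t : complex.Re (g t) = complex.Re (E t * G t) -
    c * (sin (c * t) * complex.Re (F t) + cos (c * t) * complex.Im (F t)).
  rewrite /g cE -complexiE cReD !(cReM, cImM) /= -/c. ring.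
have gIm t : complex.Im (g t) = complex.Im (E t * G t) +
    c * (cos (c * t) * complex.Re (F t) - sin (c * t) * complex.Im (F t)).
  rewrite /g cE -complexiE cImD !(cReM, cImM) /= -/c. ring.
have [ig1 ig2] := ig.
apply: complexP; rewrite /cintegral /=.
  (* The antiderivative is the real part of E F, and in the second half of the proof its imaginary
     part. The increment vanishes because E and F both take equal values at 0 and 2 pi. *)
  rewrite (@fundamental_theorem_ac _ _ _
    ((fun x => cos (c * x) * complex.Re (F x)) \-
     (fun x => sin (c * x) * complex.Im (F x))) _ pi20) //.
  - by rewrite /= cos2 sin2 !mulr0 cos0 sin0 F2pi subrr.
  - exact: ac_onB (cosM _ acRe) (sinM _ acIm).
  - move: aeF; apply: (@filterS _ _ (ae_filter_ringOfSetsType mu)) => t Ht tD.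
    have [d1 d2] := Ht tD.
    have := is_deriveB (is_deriveM (is_derive_cos_lin c t) d1)
      (is_deriveM (is_derive_sin_lin c t) d2).
    move=> h; apply: (is_derive_eq h); rewrite gRe cReM /= /GRing.scale /=; ring.
rewrite (@fundamental_theorem_ac _ _ _
    ((fun x => cos (c * x) * complex.Im (F x)) \+
     (fun x => sin (c * x) * complex.Re (F x))) _ pi20) //.
- by rewrite /= cos2 sin2 !mulr0 cos0 sin0 F2pi subrr.
- exact: ac_onD (cosM _ acIm) (sinM _ acRe).
- move: aeF; apply: (@filterS _ _ (ae_filter_ringOfSetsType mu)) => t Ht tD.
  have [d1 d2] := Ht tD.
  have := is_deriveD (is_deriveM (is_derive_cos_lin c t) d2)
    (is_deriveM (is_derive_sin_lin c t) d1).
  move=> h; apply: (is_derive_eq h); rewrite gIm cImM /= /GRing.scale /=; ring.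
Qed.

End Moments.

(** * Orthogonality with respect to a Toeplitz form *)

Lemma conjCN (C : numClosedFieldType) (x : C) : (- x)^* = - x^*.
Proof. exact: rmorphN. Qed.

Lemma conjCD (C : numClosedFieldType) (x y : C) : (x + y)^* = x^* + y^*.
Proof. exact: rmorphD. Qed.

Section Pairing.
Variables (C : numClosedFieldType) (mom : int -> C).
Hypothesis momN : forall m, mom (- m) = (mom m)^*.

(* The pairing of p with 'X^k, extended to negative k. *)
Definition pairing (p : {poly C}) (k : int) : C :=
  \sum_(j < size p) p`_j * mom (j%:Z - k).

Definition toeplitz (p q : {poly C}) : C :=
  \sum_(k < size q) (q`_k)^* * pairing p k%:Z.

(** The counterpart of [reversed] over an arbitrary closed field; the two are convertible over
    [R[i]]. *)
Definition revpoly (n : nat) (p : {poly C}) : {poly C} :=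
  \poly_(k < n.+1) (p`_(n - k))^*.

Lemma pairing_wide n (p : {poly C}) k : (size p <= n)%N ->
  pairing p k = \sum_(j < n) p`_j * mom (j%:Z - k).
Proof.
move=> sp; rewrite /pairing (big_ord_widen n (fun j => p`_j * mom (j%:Z - k)))//.
rewrite big_mkcond; apply: eq_bigr => j _; case: ifP => // /negbT.
by rewrite -leqNgt => /(nth_default 0) ->; rewrite mul0r.
Qed.

Lemma pairingD p q k : pairing (p + q) k = pairing p k + pairing q k.
Proof.
pose n := maxn (size p) (size q).
rewrite !(@pairing_wide n) ?leq_maxl ?leq_maxr ?size_polyD//.
by rewrite -big_split; apply: eq_bigr => j _; rewrite coefD mulrDl.
Qed.

Lemma pairingZ c p k : pairing (c *: p) k = c * pairing p k.
Proof.
rewrite !(@pairing_wide (size p)) ?size_scale_leq// mulr_sumr.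
by apply: eq_bigr => j _; rewrite coefZ mulrA.
Qed.

Lemma pairingB p q k : pairing (p - q) k = pairing p k - pairing q k.
Proof. by rewrite pairingD -scaleN1r pairingZ mulN1r. Qed.

Lemma pairingXM p k : pairing ('X * p) k = pairing p (k - 1).
Proof.
rewrite (@pairing_wide (size p).+1); last first.
  by apply: leq_trans (size_polyMleq _ _) _; rewrite size_polyX.
rewrite big_ord_recl coefXM mul0r add0r; apply: eq_bigr => j _.
by rewrite coefXM /=; congr (_ * mom _); rewrite /bump /=; lia.
Qed.

Lemma pairingXnM i p k : pairing ('X^i * p) k = pairing p (k - i%:Z).
Proof.
elim: i k => [|i IH] k; first by rewrite mul1r subr0.
by rewrite exprS -mulrA pairingXM IH; congr pairing; lia.
Qed.

(** On the unit circle the reversed polynomial is z^n times the conjugate of p, which exchanges the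
    exponents k and n - k up to conjugation. *)
Lemma pairing_rev n (p : {poly C}) k : (size p <= n.+1)%N ->
  pairing (revpoly n p) k = (pairing p (n%:Z - k))^*.
Proof.
move=> sp; rewrite (@pairing_wide n.+1) ?size_poly// (pairing_wide _ sp) conjC_sum.
rewrite (reindex_inj rev_ord_inj); apply: eq_bigr => j _ /=.
have jn : (j <= n)%N by rewrite -ltnS.
rewrite coef_poly subSS ltnS leq_subr subKn// conjCM -momN.
by congr (_ * mom _); lia.
Qed.

Lemma toeplitz_conj p q : (toeplitz p q)^* = toeplitz q p.
Proof.
rewrite /toeplitz /pairing conjC_sum.
under eq_bigr do rewrite conjCM conjC_sum mulr_sumr.
rewrite exchange_big; apply: eq_bigr => j _ /=.
rewrite mulr_sumr; apply: eq_bigr => k _.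
by rewrite conjCM conjCK -momN opprB mulrCA.
Qed.

Section Orthogonal.
Variable Phi : nat -> {poly C}.
Hypothesis Phi_monic : forall n, Phi n \is monic.
Hypothesis size_Phi : forall n, size (Phi n) = n.+1.
Hypothesis Phi_orth : forall n m, n != m -> toeplitz (Phi n) (Phi m) = 0.
Hypothesis definite : forall p, toeplitz p p = 0 -> p = 0.

Definition alpha n : C := - ((Phi n.+1).[0])^*.
(** By [toeplitz_Phi] this is the squared norm of [Phi n]. *)
Definition hnorm n : C := pairing (Phi n) n%:Z.

Lemma coef_lead n : (Phi n)`_n = 1.
Proof. by have /monicP := Phi_monic n; rewrite /lead_coef size_Phi. Qed.

Lemma coef_Phi_gt n j : (n < j)%N -> (Phi n)`_j = 0.
Proof. by move=> nj; rewrite nth_default ?size_Phi. Qed.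

(** Strong induction on k: in the orthogonality of [Phi n] to the monic [Phi k], the terms of
    exponent below k vanish by induction, which leaves the one of exponent k. *)
Lemma pairing_Phi_nat n k : (k < n)%N -> pairing (Phi n) k%:Z = 0.
Proof.
have [m] := ubnP k; elim: m k => // m IH k km kn.
have := Phi_orth (negbT (gtn_eqF kn)).
rewrite /toeplitz size_Phi big_ord_recr /= coef_lead conjC1 mul1r.
rewrite big1 ?add0r// => j _; rewrite IH ?mulr0//.
  by rewrite (leq_trans (ltn_ord j)).
exact: ltn_trans (ltn_ord j) kn.
Qed.

Lemma pairing_Phi n (k : int) : 0 <= k -> k < n%:Z -> pairing (Phi n) k = 0.
Proof. by case: k => // k _ kn; exact: pairing_Phi_nat. Qed.

Lemma toeplitz_Phi n : toeplitz (Phi n) (Phi n) = hnorm n.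
Proof.
rewrite /toeplitz size_Phi big_ord_recr /= coef_lead conjC1 mul1r.
by rewrite big1 ?add0r// => j _; rewrite pairing_Phi_nat ?mulr0.
Qed.

Lemma hnorm_conj n : (hnorm n)^* = hnorm n.
Proof. by rewrite -toeplitz_Phi toeplitz_conj. Qed.

Lemma pairing_eq0 n (E : {poly C}) : (size E <= n)%N ->
  (forall k, (k < n)%N -> pairing E k%:Z = 0) -> E = 0.
Proof.
move=> sE E0; apply: definite; rewrite /toeplitz big1// => k _.
by rewrite E0 ?mulr0// (leq_trans (ltn_ord k)).
Qed.

(* How every polynomial identity below is proved: the difference D of the two
   sides vanishes at 0 and is orthogonal to 'X, ..., 'X^n. *)
Lemma pairing_eq0_shift n (D : {poly C}) : (size D <= n.+1)%N -> D`_0 = 0 ->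
  (forall k, (k < n)%N -> pairing D k.+1%:Z = 0) -> D = 0.
Proof.
move=> sD D0 Dk; pose E := \poly_(i < n) D`_i.+1.
have DE : D = 'X * E.
  apply/polyP => -[|i]; rewrite coefXM //= coef_poly.
  by case: ltnP => // ni; rewrite nth_default// (leq_trans sD).
rewrite DE (@pairing_eq0 n E) ?mulr0 ?size_poly// => k kn.
by have := Dk k kn; rewrite DE pairingXM => <-; congr pairing; lia.
Qed.

Lemma alpha_conj n : (alpha n)^* = - (Phi n.+1)`_0.
Proof. by rewrite /alpha horner_coef0 rmorphN /= conjCK. Qed.

Lemma coef_rev n k (p : {poly C}) : (k <= n)%N -> (revpoly n p)`_k = (p`_(n - k))^*.
Proof. by move=> kn; rewrite coef_poly ltnS kn. Qed.

(** The factor of the reversed polynomial is forced by the value at 0, where that polynomial is 1.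
    All three polynomials are orthogonal to the powers of z from 1 to n. *)
Lemma szego n : Phi n.+1 = 'X * Phi n - (alpha n)^* *: revpoly n (Phi n).
Proof.
apply/eqP; rewrite -subr_eq0; apply/eqP.
apply: (@pairing_eq0_shift n).
- apply/leq_sizeP => j; rewrite leq_eqVlt => /predU1P[<-|nj].
    rewrite !(coefB, coefZ, coefXM) /= !coef_lead coef_poly ltnn.
    by rewrite mulr0 subr0 subrr.
  rewrite !(coefB, coefZ, coefXM) coef_poly [(Phi n.+1)`_j]coef_Phi_gt//.
  case: j nj => // j nj /=; rewrite [(Phi n)`_j]coef_Phi_gt//.
  have -> : (j.+1 < n.+1)%N = false by lia.
  by rewrite mulr0 !subr0.
- rewrite !(coefB, coefZ, coefXM) /= coef_rev// subn0 coef_lead conjC1 alpha_conj.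
  by rewrite mulr1 sub0r opprK subrr.
- move=> k kn; rewrite !(pairingB, pairingZ, pairingXM) pairing_rev ?size_Phi//.
  rewrite !pairing_Phi; try lia.
  rewrite conjC0 mulr0; by rewrite !subrr.
Qed.

(** * Pairings of [Phi n] with exponents outside 0, ..., n - 1 *)

Lemma pairing_szego n k : pairing (Phi n.+1) k =
  pairing (Phi n) (k - 1) - (alpha n)^* * (pairing (Phi n) (n%:Z - k))^*.
Proof.
by rewrite {1}szego !(pairingB, pairingZ, pairingXM) pairing_rev ?size_Phi.
Qed.

(** The Szego recurrence at exponent 0, where [Phi n.+1] pairs to 0. *)
Lemma pairing_Phi_N1 n : pairing (Phi n) (- 1) = (alpha n)^* * hnorm n.
Proof.
have := pairing_szego n 0; rewrite pairing_Phi// sub0r subr0 hnorm_conj => /esym/eqP.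
by rewrite subr_eq0 => /eqP.
Qed.

Lemma hnormS n : hnorm n.+1 = (1 - (alpha n)^* * alpha n) * hnorm n.
Proof.
rewrite {1}/hnorm pairing_szego.
have -> : n.+1%:Z - 1 = n%:Z by lia.
have -> : n%:Z - n.+1%:Z = -1 by lia.
by rewrite pairing_Phi_N1 conjCM conjCK hnorm_conj -/(hnorm n); ring.
Qed.

(** In the orthogonality of [Phi n] to [Phi n.+1] only the two highest exponents n and n + 1
    survive. *)
Lemma pairing_Phi_succ n :
  pairing (Phi n) n.+1%:Z = - ((Phi n.+1)`_n)^* * hnorm n.
Proof.
have nS : n != n.+1 by rewrite neq_ltn ltnSn.
have := Phi_orth nS; rewrite /toeplitz size_Phi !big_ord_recr /= coef_lead conjC1.
rewrite big1; last by move=> j _; rewrite pairing_Phi_nat ?mulr0.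
rewrite -/(hnorm n) add0r mul1r mulNr => /eqP.
by rewrite addr_eq0 => /eqP ->; rewrite opprK.
Qed.

(** The Szego recurrence at exponent -1: besides the wanted value it involves only the pairing of
    [Phi n.+1] with -1 and that of [Phi n] with n + 1, both known. *)
Lemma pairing_Phi_N2 n : pairing (Phi n) (- 2) =
  ((alpha n.+1)^* * (1 - (alpha n)^* * alpha n) - (alpha n)^* * (Phi n.+1)`_n)
  * hnorm n.
Proof.
have := pairing_szego n (- 1).
have -> : (-1 : int) - 1 = -2 by [].
have -> : n%:Z - -1 = n.+1%:Z by lia.
rewrite pairing_Phi_N1 pairing_Phi_succ hnormS.
rewrite conjCM conjCN conjCK hnorm_conj => h.
have E (y z t u v : C) : t * ((1 - z * u) * y) + z * (- v * y) =
  (t * (1 - z * u) - z * v) * y by ring.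
by rewrite -[LHS](subrK ((alpha n)^* * (- (Phi n.+1)`_n * hnorm n))) -h E.
Qed.

(** Allows the subleading coefficients of consecutive degrees, which all occur in the coefficients
    of U and V, to be expressed through a single one. *)
Lemma coef_subleading n : (Phi n.+2)`_n.+1 = (Phi n.+1)`_n + (alpha n.+1)^* * alpha n.
Proof.
rewrite {1}szego coefB coefXM coefZ /= coef_rev// subnn.
have aE : alpha n = - ((Phi n.+1)`_0)^* by rewrite /alpha horner_coef0.
by rewrite aE mulrN.
Qed.

(** The arguments start with the constant term, while the sum is written as in [U_poly], so that
    [U_poly] is a [cubic] by conversion. Reversal then simply reverses and conjugates the
    arguments. *)
Definition cubic (c0 c1 c2 c3 : C) : {poly C} :=
  c3 *: 'X^3 + c2 *: 'X^2 + c1 *: 'X + c0%:P.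

Lemma cubicM c0 c1 c2 c3 (p : {poly C}) : cubic c0 c1 c2 c3 * p =
  c3 *: ('X^3 * p) + c2 *: ('X^2 * p) + c1 *: ('X * p) + c0 *: p.
Proof. by rewrite /cubic !mulrDl -!scalerAl mul_polyC. Qed.

Lemma cubicE (p : {poly C}) : (size p <= 4)%N -> p = cubic p`_0 p`_1 p`_2 p`_3.
Proof.
move=> sp; apply/polyP => i; rewrite !(coefD, coefZ, coefXn, coefX, coefC).
case: i => [|[|[|[|i]]]] /=; rewrite ?mulr0 ?mulr1 ?addr0 ?add0r//.
by rewrite nth_default// (leq_trans sp).
Qed.

Lemma pairing_cubicM c0 c1 c2 c3 (p : {poly C}) k : pairing (cubic c0 c1 c2 c3 * p) k =
  c0 * pairing p k + c1 * pairing p (k - 1) + c2 * pairing p (k - 2)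
  + c3 * pairing p (k - 3).
Proof. by rewrite cubicM !(pairingD, pairingZ, pairingXnM, pairingXM); ring. Qed.

Lemma coef_cubicM c0 c1 c2 c3 (p : {poly C}) i : (cubic c0 c1 c2 c3 * p)`_i.+3 =
  c0 * p`_i.+3 + c1 * p`_i.+2 + c2 * p`_i.+1 + c3 * p`_i.
Proof. 
rewrite cubicM !(coefD, coefZ, coefXnM, coefXM) /= !subSS !subn0; ring.
Qed.

Lemma coef0_cubicM c0 c1 c2 c3 (p : {poly C}) : (cubic c0 c1 c2 c3 * p)`_0 = c0 * p`_0.
Proof.
by rewrite cubicM !(coefD, coefZ, coefXnM, coefXM) /= !mulr0 !add0r.
Qed.

(** Both sides are linear in p. For p = z^i the moment identity at m = i - k trades the factor i
    produced by differentiation for k and B. *)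
Lemma pairing_pearson (A B : {poly C}) :
  (forall m : int,
     \sum_(j < 4) (m%:~R * A`_j - 'i * B`_j) * mom (m + j%:Z) = 0) ->
  (size A <= 4)%N -> forall p k,
  pairing (A * ('X * p^`())) k =
  (k%:~R * A`_0 + 'i * B`_0) * pairing p k
  + (k%:~R * A`_1 + 'i * B`_1) * pairing p (k - 1)
  + (k%:~R * A`_2 + 'i * B`_2) * pairing p (k - 2)
  + (k%:~R * A`_3 + 'i * B`_3) * pairing p (k - 3).
Proof.
move=> pm sA p k; rewrite {1}(cubicE sA) pairing_cubicM.
have dE l : pairing ('X * p^`()) l = \sum_(i < size p) i%:R * (p`_i * mom (i%:Z - l)).
  rewrite (@pairing_wide (size p)); last first.
    apply/leq_sizeP => -[|j] sj; rewrite coefXM //= coef_deriv.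
    by rewrite nth_default ?mul0rn.
  apply: eq_bigr => i _; rewrite coefXM; case: (nat_of_ord i) => [|j] /=.
    by rewrite !mul0r.
  by rewrite coef_deriv -[_ *+ _]mulr_natl mulrA.
rewrite !dE /pairing.
apply/eqP; rewrite -subr_eq0; apply/eqP.
rewrite !mulr_sumr -!big_split -sumrB big1// => i _ /=.
have := pm (i%:Z - k); rewrite !big_ord_recl big_ord0 /= /bump /=.
have -> : i%:Z - k + 0%N%:Z = i%:Z - k by lia.
have -> : i%:Z - k + (1 + 0)%N%:Z = i%:Z - (k - 1) by lia.
have -> : i%:Z - k + (1 + (1 + 0))%N%:Z = i%:Z - (k - 2) by lia.
have -> : i%:Z - k + (1 + (1 + (1 + 0)))%N%:Z = i%:Z - (k - 3) by lia.
rewrite !addn0 !add1n => h.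
apply: etrans (etrans (congr1 (fun x => p`_i * x) h) (mulr0 _)).
have -> : (i%:Z - k)%:~R = i%:R - k%:~R :> C by rewrite intrD mulrNz.
by ring.
Qed.

(** * The first-order relation for z A Phi_n' *)

Section Structure.
Variables A B : {poly C}.
Hypothesis moments : forall m : int,
  \sum_(j < 4) (m%:~R * A`_j - 'i * B`_j) * mom (m + j%:Z) = 0.
Hypothesis sA : (size A <= 4)%N.
Variable n : nat.
Hypothesis n3 : (3 <= n)%N.

Let p := Phi n.
Let r := revpoly n p.
Let a j := A`_j.
Let b j := B`_j.
(** The coefficients in the shape in which the pairings deliver them; [first_order_relation] matches
    them with those of [U_poly] and [V_poly]. *)
Let U0 := 'i * b 0 + n%:R * a 0.
Let V0 := U0 * (alpha n.-1)^*.
Let V2 := ('i * b 3 + 2 * a 3 - n%:R * a 3) * (alpha n)^*.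
Let U2 := n%:R * a 2 - a 3 * (Phi n)`_n.-1 + V2 * alpha n.-1.
Let U1 := 'i * b 1 + n.+1%:R * a 1 - a 0 * ((Phi n.+1)`_n)^* - V0 * alpha n.
Let V1 := ('i * b 2 + a 2) * (alpha n)^*
  + ('i * b 3 + a 3 - n%:R * a 3)
    * ((alpha n.+1)^* * (1 - (alpha n)^* * alpha n) - (alpha n)^* * (Phi n.+1)`_n)
  - U2 * (alpha n)^* + V2 * (Phi n.+1)`_n.

(* The exponents 3, ..., n - 1 give no condition; each of the coefficients is fixed
   by one remaining exponent: V2 by 2, V1 by 1, U0 by n, U1 by n + 1, while V0, U2 and
   U3 come from the coefficients 0, n + 2 and n + 3. *)
Lemma structure_relation :
  A * ('X * p^`()) =
  cubic U0 U1 U2 (n%:R * a 3) * p + cubic V0 V1 V2 0 * r.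
Proof.
have nE : n = n.-1.+1 by rewrite prednK// (leq_trans _ n3).
have p0E : p`_0 = - (alpha n.-1)^* by rewrite alpha_conj opprK -nE.
have pnE : p`_n = 1 by exact: coef_lead.
have r0E : r`_0 = 1 by rewrite /r coef_rev// subn0 pnE conjC1.
have rnE : r`_n = - alpha n.-1 by rewrite /r coef_rev// subnn p0E conjCN conjCK.
have p_gt j : (n < j)%N -> p`_j = 0 by exact: coef_Phi_gt.
have r_gt j : (n < j)%N -> r`_j = 0 by move=> nj; rewrite coef_poly ltnS leqNgt nj.
have XdE j : ('X * p^`())`_j = j%:R * p`_j.
  by rewrite coefXM; case: j => [|j] /=; rewrite ?mul0r// coef_deriv mulr_natl.
have tz x : 0 <= x -> x < n%:Z -> pairing p x = 0 by exact: pairing_Phi.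
(* The exponent is given up to an equation, so that differences such as 1 - 2 can be matched by
   [lia]. *)
have tm1 x : x = -1 -> pairing p x = (alpha n)^* * hnorm n.
  by move=> ->; exact: pairing_Phi_N1.
have tm2 x : x = -2 -> pairing p x = ((alpha n.+1)^* * (1 - (alpha n)^* * alpha n)
    - (alpha n)^* * (Phi n.+1)`_n) * hnorm n.
  by move=> ->; exact: pairing_Phi_N2.
have tn x : x = n%:Z -> pairing p x = hnorm n by move=> ->.
have tn1 x : x = n.+1%:Z -> pairing p x = - ((Phi n.+1)`_n)^* * hnorm n.
  by move=> ->; exact: pairing_Phi_succ.
(* Three goals remain: the coefficients from n + 2 on, the constant coefficient, and the pairings
   with the exponents 1 to n + 1. *)
apply/eqP; rewrite -subr_eq0; apply/eqP; apply: (@pairing_eq0_shift n.+1).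
- apply/leq_sizeP => j; case: j => [|[|[|j]]] //; try lia.
  move=> nj; rewrite coefB coefD !coef_cubicM {1}(cubicE sA) coef_cubicM !XdE.
  (* The index has been lowered by 3: j = n and j = n - 1 stand for the coefficients n + 3 and n +
     2, and beyond them everything vanishes. *)
  have [jn|nj'] := leqP j n; last first.
    have [nj1 nj2 nj3] := And3 (leqW nj') (leqW (leqW nj')) (leqW (leqW (leqW nj'))).
    rewrite (p_gt _ nj') (p_gt _ nj1) (p_gt _ nj2) (p_gt _ nj3).
    rewrite (r_gt _ nj') (r_gt _ nj1) (r_gt _ nj2) (r_gt _ nj3).
    by rewrite !mulr0 !addr0 subrr.
  have nn1 := ltnSn n; have nn2 := leqW nn1; have nn3 := leqW nn2.
  have [->|jn'] := eqVneq j n.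
    rewrite pnE (p_gt _ nn1) (p_gt _ nn2) (p_gt _ nn3).
    rewrite (r_gt _ nn1) (r_gt _ nn2) (r_gt _ nn3).
    by rewrite !mulr0 !add0r !mulr1 mul0r addr0 mulrC subrr.
  have -> : j = n.-1 by clear -nj jn jn' n3; lia.
  rewrite -nE pnE rnE (p_gt _ nn1) (p_gt _ nn2) (r_gt _ nn1) (r_gt _ nn2).
  rewrite /U2 /V2 /a /b /p.
  have -> : n%:R = n.-1%:R + 1 :> C by rewrite natr1 -nE.
  by ring.
- rewrite coefB coefD !coef0_cubicM {1}(cubicE sA) coef0_cubicM coefXM /=.
  by rewrite p0E r0E /V0; ring.
- move=> k kn.
  rewrite pairingB pairingD !pairing_cubicM (pairing_pearson moments sA).
  rewrite !pairing_rev ?size_Phi// -/p.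
  have h_conj := hnorm_conj n.
  (* The exponent tested is k + 1. As n is at least 3, the low exponents 1 and 2, which reach the
     pairings at -1 and -2, are distinct from the high ones n and n + 1. *)
  have [->|k0] := eqVneq k 0%N.
    rewrite (tz 1); [|lia|lia]; rewrite (tz (1 - 1)); [|lia|lia].
    rewrite (tm1 (1 - 2)); [|lia]; rewrite (tm2 (1 - 3)); [|lia].
    rewrite (tz (n%:Z - 1)); [|lia|lia]; rewrite (tn (n%:Z - (1 - 1))); [|lia].
    rewrite (tn1 (n%:Z - (1 - 2))); [|lia].
    rewrite conjCM conjCN conjCK h_conj conjC0 /V1 /U2 /V2 /a /b; ring.
  have [->|k1] := eqVneq k 1%N.
    rewrite (tz 2); [|lia|lia]; rewrite (tz (2%N%:Z - 1)); [|lia|lia].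
    rewrite (tz (2%N%:Z - 2)); [|lia|lia]; rewrite (tm1 (2%N%:Z - 3)); [|lia].
    rewrite (tz (n%:Z - 2)); [|lia|lia]; rewrite (tz (n%:Z - (2%N%:Z - 1))); [|lia|lia].
    rewrite (tn (n%:Z - (2%N%:Z - 2))); [|lia].
    by rewrite h_conj conjC0 /V2 /a /b; ring.
  have [kn1|kn1] := ltnP k.+1 n.
    rewrite (tz k.+1); [|lia|lia]; rewrite (tz (k.+1%:Z - 1)); [|lia|lia].
    rewrite (tz (k.+1%:Z - 2)); [|lia|lia]; rewrite (tz (k.+1%:Z - 3)); [|lia|lia].
    rewrite (tz (n%:Z - k.+1%:Z)); [|lia|lia].
    rewrite (tz (n%:Z - (k.+1%:Z - 1))); [|lia|lia].
    rewrite (tz (n%:Z - (k.+1%:Z - 2))); [|lia|lia].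
    by rewrite conjC0; ring.
  have [->|kn2] := eqVneq k.+1 n.
    rewrite (tn n); [|lia]; rewrite (tz (n%:Z - 1)); [|lia|lia].
    rewrite (tz (n%:Z - 2)); [|lia|lia]; rewrite (tz (n%:Z - 3)); [|lia|lia].
    rewrite (tz (n%:Z - n%:Z)); [|lia|lia].
    rewrite (tz (n%:Z - (n%:Z - 1))); [|lia|lia].
    rewrite (tz (n%:Z - (n%:Z - 2))); [|lia|lia].
    by rewrite conjC0 /U0 /a /b -[n%:~R]/(n%:R); ring.
  have -> : k.+1 = n.+1 by lia.
  rewrite (tn1 n.+1); [|lia]; rewrite (tn (n.+1%:Z - 1)); [|lia].
  rewrite (tz (n.+1%:Z - 2)); [|lia|lia]; rewrite (tz (n.+1%:Z - 3)); [|lia|lia].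
  rewrite (tm1 (n%:Z - n.+1%:Z)); [|lia].
  rewrite (tz (n%:Z - (n.+1%:Z - 1))); [|lia|lia].
  rewrite (tz (n%:Z - (n.+1%:Z - 2))); [|lia|lia].
  rewrite conjCM conjCK h_conj conjC0 /U1 /V0 /U0 /a /b -[n.+1%:~R]/(n.+1%:R).
  by rewrite -natr1; ring.
Qed.
End Structure.
End Orthogonal.
End Pairing.

(** * Reversal and elimination of the reversed polynomial *)

Section Reversal.
Variables (C : numClosedFieldType).
Implicit Types (p q : {poly C}) (n : nat).

Lemma revpolyD n p q : revpoly n (p + q) = revpoly n p + revpoly n q.
Proof.
apply/polyP => i; rewrite coefD !coef_poly coefD conjCD.
by case: ifP; rewrite ?addr0.
Qed.

Lemma revpolyZ n c p : revpoly n (c *: p) = c^* *: revpoly n p.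
Proof.
apply/polyP => i; rewrite coefZ !coef_poly coefZ conjCM.
by case: ifP; rewrite ?mulr0.
Qed.

Lemma revpolyXM n p : revpoly n.+1 ('X * p) = revpoly n p.
Proof.
apply/polyP => i; rewrite !coef_poly coefXM subn_eq0.
rewrite ltnS; have [ni|ni|ni] := ltngtP i n.+1; last by rewrite conjC0.
  by rewrite subSn.
by [].
Qed.

Lemma revpoly_succ n p : (size p <= n.+1)%N -> revpoly n.+1 p = 'X * revpoly n p.
Proof.
move=> sp; apply/polyP => -[|i]; rewrite coefXM !coef_poly //=.
by rewrite nth_default ?conjC0.
Qed.

Lemma revpolyK n p : (size p <= n.+1)%N -> revpoly n (revpoly n p) = p.
Proof.
move=> sp; apply/polyP => i; rewrite coef_poly; case: ltnP => ni; last first.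
  by rewrite nth_default// (leq_trans sp).
by rewrite coef_poly ltnS leq_subr conjCK subKn.
Qed.

Lemma revpoly_cubicM n c0 c1 c2 c3 p : (size p <= n.+1)%N ->
  revpoly n.+3 (cubic c0 c1 c2 c3 * p) =
  cubic c3^* c2^* c1^* c0^* * revpoly n p.
Proof.
move=> sp; have sX m q : (size q <= m)%N -> (size ('X * q)%R <= m.+1)%N.
  by move=> sq; apply: leq_trans (size_polyMleq _ _) _; rewrite size_polyX.
rewrite !cubicM !revpolyD !revpolyZ !exprS expr0 mulr1 -!mulrA !revpolyXM.
rewrite !(revpoly_succ (n := n.+2)) ?(revpoly_succ (n := n.+1))
  ?(revpoly_succ (n := n))//; [|exact: leqW sp|exact: leqW (leqW sp)].
by rewrite -!mul_polyC; ring.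
Qed.

(** The coefficient of index i comes from that of index n - i in p, and i = n - (n - i). *)
Lemma deriv_revpoly n p : (size p <= n.+1)%N ->
  'X * (revpoly n p)^`() = n%:R *: revpoly n p - revpoly n ('X * p^`()).
Proof.
move=> sp; have XdE q j : ('X * q^`())`_j = j%:R * q`_j.
  by rewrite coefXM; case: j => [|j] /=; rewrite ?mul0r// coef_deriv mulr_natl.
apply/polyP => i; rewrite XdE coefB coefZ !coef_poly XdE ltnS.
case: leqP => ni; last by rewrite !mulr0 subr0.
by rewrite conjCM conjC_nat natrB//; ring.
Qed.

(** The relation is reversed with index n + 3, and [deriv_revpoly] converts the reversal of z p'
    into the derivative of the reversed polynomial. *)
Lemma reversed_relation n p a0 a1 a2 a3 U0 U1 U2 V0 V1 V2 :
  (size p <= n.+1)%N ->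
  cubic a0 a1 a2 a3 * ('X * p^`()) =
    cubic U0 U1 U2 (n%:R * a3) * p + cubic V0 V1 V2 0 * revpoly n p ->
  cubic a3^* a2^* a1^* a0^* * (revpoly n p)^`() =
    - (cubic (U2^* - n%:R * a2^* ) (U1^* - n%:R * a1^* ) (U0^* - n%:R * a0^* ) 0
         * revpoly n p
       + cubic V2^* V1^* V0^* 0 * p).
Proof.
move=> sp; have sX : (size ('X * p^`())%R <= n.+1)%N.
  apply: leq_trans sp; apply/leq_sizeP => -[|j] sj; rewrite coefXM //=.
  by rewrite coef_deriv nth_default ?mul0rn.
move=> /(congr1 (revpoly n.+3)).
rewrite revpolyD !revpoly_cubicM ?size_poly// revpolyK// => S1.
(* A factor z can be cancelled: the leading coefficient n a3 of U makes the constant terms in front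
   of the reversed polynomial cancel, and V has no cubic term. *)
apply: (mulfI (negbT (polyX_eq0 C))); rewrite mulrCA deriv_revpoly// mulrBr S1.
rewrite conjCM conjC_nat conjC0 /cubic -!mul_polyC.
rewrite !(polyCB, polyCM, polyC0); ring.
Qed.

End Reversal.

Lemma second_order_equation (F : fieldType) (A p r U V W Y Ah : {poly F}) (z : F) :
  A * ('X * p^`()) = U * p + V * r ->
  Ah * r^`() = - (Y * r + W * p) -> Ah.[z] != 0 ->
  let Theta := if V == 0 then 0 else 1 in
  z * A.[z] * p^`(2).[z]
  + (('X * A)^`().[z] - U.[z] + Theta * (z * A.[z] * Y.[z] * Ah.[z]^-1)) * p^`().[z]
  - (Theta * ((Y.[z] * U.[z] - V.[z] * W.[z]) * Ah.[z]^-1) + U^`().[z]) * p.[z]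
  = V^`().[z] * r.[z].
Proof.
move=> S1 S2 hz Theta.
have e1 := congr1 (horner^~ z) S1.
have e2 := congr1 (horner^~ z) S2.
have e3 := congr1 (fun q => q^`().[z]) S1.
move: e1 e2 e3; rewrite derivSn derivn1 !(derivM, derivD, derivX) !hornerE /=.
move: p^`()^`().[z] p^`().[z] r^`().[z] => p2 p1 r1 e1 e2 e3.
apply: subr0_eq; rewrite /Theta; case: eqP => [V0|_].
  (* If V is the zero polynomial, the derivative of the first relation is already the claim. *)
  transitivity (A^`().[z] * z * p1 + A.[z] * (p1 + z * p2) -
    (U^`().[z] * p.[z] + U.[z] * p1 + V^`().[z] * r.[z] + V.[z] * r1)).
    by rewrite V0 deriv0 horner0; ring.
  by rewrite e3 subrr.
have e2' : r1 + (Y.[z] * r.[z] + W.[z] * p.[z]) / Ah.[z] = 0.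
  by rewrite -[Y.[z] * _ + _]opprK -e2 mulNr mulrAC mulfV// mul1r subrr.
(* Otherwise the claim is the derivative of the first relation, plus Y / Ah times the first
   relation, plus V times the second one divided by Ah. *)
transitivity ((A^`().[z] * z * p1 + A.[z] * (p1 + z * p2) -
    (U^`().[z] * p.[z] + U.[z] * p1 + V^`().[z] * r.[z] + V.[z] * r1)) +
  Y.[z] / Ah.[z] * (A.[z] * z * p1 - (U.[z] * p.[z] + V.[z] * r.[z])) +
  V.[z] * (r1 + (Y.[z] * r.[z] + W.[z] * p.[z]) / Ah.[z])).
  by field.
by rewrite e1 e2' e3 !subrr !mulr0 !addr0.
Qed.

(** * Matching the coefficients with U_n, V_n, W_n and Y_n *)

Section Main.
Variables (R : realType) (A B : {poly R[i]}) (w : R -> R) (Phi : nat -> {poly R[i]}).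
Hypotheses (hA : (size A <= 4)%N) (hB : (size B <= 4)%N).
Hypotheses (hw : positive_weight w) (hP : pearson A B w).
Hypothesis hbd : A.[1] * (w (2 * pi) - w 0)%:C%C = 0.
Hypothesis hPhi : monic_opuc w Phi.
Variable n : nat.
Hypothesis hn : (3 <= n)%N.
Local Notation al := (verblunsky Phi).

Let Phi_monic m : Phi m \is monic.
Proof. by have [/(_ m)[]] := hPhi. Qed.

Let size_Phi m : size (Phi m) = m.+1.
Proof. by have [/(_ m)[]] := hPhi. Qed.

Let Phi_orth m k : m != k -> toeplitz (moment w) (Phi m) (Phi k) = 0.
Proof.
by move=> mk; rewrite /toeplitz /pairing -inner_moment//; case: hPhi => _; apply.
Qed.

Let definite p : toeplitz (moment w) p p = 0 -> p = 0.
Proof. by rewrite /toeplitz /pairing -inner_moment//; exact: inner_definite. Qed.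

(** This is [pearson_moment] multiplied by -i, the form used by [pairing_pearson]. *)
Let moments (m : int) :
  \sum_(j < 4) (m%:~R * A`_j - 'i * B`_j) * moment w (m + j%:Z) = 0.
Proof.
have pm := pearson_moment hw m hA hB hP hbd.
apply: etrans (etrans (congr1 (fun x => - 'i * x) pm) (mulr0 _)); rewrite mulr_sumr.
apply: eq_bigr => j _; rewrite mulrA; congr (_ * _).
have ii : 'i * 'i = -1 :> R[i] by rewrite -expr2 sqrCi.
transitivity (- ('i * 'i) * (m%:~R * A`_j) - 'i * B`_j); last by ring.
by rewrite ii opprK mul1r.
Qed.

Let subleading m : (Phi m.+2)`_m.+1 = (Phi m.+1)`_m + (al m.+1)^* * al m.
Proof. exact: (coef_subleading (momentN hw) Phi_monic size_Phi Phi_orth definite). Qed.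

Let U0 := 'i * B`_0 + n%:R * A`_0.
Let U2 := s1_coef A B Phi n + n%:R * A`_3 * (al n.+1)^* * al n.
Let V0 := U0 * (al n.-1)^*.
Let V1 := - (s1_coef A B Phi n * (al n)^* + n%:R * A`_3 * (al n.+1)^*
     - t_coef A B Phi n).
Let V2 := ('i * B`_3 - (n%:R - 2) * A`_3) * (al n)^*.

Let VE : V_poly A B Phi n = cubic V0 V1 V2 0.
Proof. by rewrite /cubic scale0r add0r scaleNr. Qed.

Lemma first_order_relation :
  A * ('X * (Phi n)^`()) =
  U_poly A B Phi n * Phi n + V_poly A B Phi n * reversed n (Phi n).
Proof.
have nE : n = n.-1.+1 by rewrite prednK// (leq_trans _ hn).
rewrite (structure_relation (momentN hw) Phi_monic size_Phi Phi_orth definite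
  moments hA hn).
(* All subleading coefficients are reduced to that of [Phi n], after which the coefficients agree as
   ring expressions. *)
have sub0 : (Phi n.+1)`_n = (Phi n)`_n.-1 + (al n)^* * al n.-1.
  by have := subleading n.-1; rewrite -nE.
have sub1 := subleading n.
rewrite VE; change (U_poly A B Phi n) with
  (cubic U0 (s_coef A B Phi n) U2 (n%:R * A`_3)).
rewrite -[reversed n (Phi n)]/(revpoly n (Phi n)).
change (alpha Phi) with al.
congr (cubic _ _ _ _ * _ + cubic _ _ _ _ * _).
- rewrite /s_coef sub0 conjCD conjCM conjCK; ring.
- rewrite /U2 /s1_coef sub1 sub0; ring.
- rewrite /V1 /s1_coef /t_coef sub1 sub0 normCK; ring.
- rewrite /V2; ring.
Qed.

Lemma reversed_first_order_relation :
  Ahat A * (reversed n (Phi n))^`() =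
  - (Y_poly A B Phi n * reversed n (Phi n) + W_poly A B Phi n * Phi n).
Proof.
have := first_order_relation.
rewrite VE {1}(cubicE hA); change (U_poly A B Phi n) with
  (cubic U0 (s_coef A B Phi n) U2 (n%:R * A`_3)).
rewrite -[reversed n (Phi n)]/(revpoly n (Phi n)).
move/(reversed_relation (eq_leq (size_Phi n))) => S2.
have U0C : U0^* = - 'i * (B`_0)^* + n%:R * (A`_0)^*.
  by rewrite /U0 conjCD !conjCM conjCi conjC_nat.
have U2C : U2^* = (s1_coef A B Phi n)^* + n%:R * (A`_3)^* * al n.+1 * (al n)^*.
  by rewrite /U2 conjCD !conjCM conjCK conjC_nat.
have -> : Y_poly A B Phi n = cubic (U2^* - n%:R * (A`_2)^* )
    ((s_coef A B Phi n)^* - n%:R * (A`_1)^* ) (U0^* - n%:R * (A`_0)^* ) 0.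
  by rewrite U0C U2C addrK /cubic scale0r add0r.
have -> : W_poly A B Phi n = cubic V2^* V1^* V0^* 0.
  rewrite /cubic scale0r add0r /W_poly /V0 conjCM U0C conjCK; congr (_ + _ + _%:P).
    rewrite -scaleNr; congr (_ *: _).
    by rewrite /V1 conjCN !(conjCD, conjCN, conjCM) !conjCK conjC_nat.
  (* The constant term of W is the conjugate of [V2], split into the conjugate of [p_coef] and the
     term carrying the factor n. *)
  rewrite /V2 /p_coef conjCM [RHS]conjCM !conjCK.
  by rewrite !(conjCD, conjCN, conjCM) !conjC1 !conjC_nat; ring.
exact: S2.
Qed.

End Main.

Theorem theorem3p6 (R : realType) (A B : {poly R[i]}) (w : R -> R)
    (Phi : nat -> {poly R[i]})
    (hA : (size A <= 4)%N) (hB : (size B <= 4)%N)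
    (hw : positive_weight w)
    (hP : pearson A B w)
    (hbd : A.[1] * (w (2 * pi) - w 0)%:C%C = 0)
    (hPhi : monic_opuc w Phi)
    (n : nat) (hn : (3 <= n)%N)
    (z : R[i]) (hz : (Ahat A).[z] != 0) :
  let U := U_poly A B Phi n in
  let V := V_poly A B Phi n in
  let W := W_poly A B Phi n in
  let Y := Y_poly A B Phi n in
  let Theta := step_of V in
  z * A.[z] * (Phi n)^`(2).[z]
  + (('X * A)^`().[z] - U.[z] + Theta * (z * A.[z] * Y.[z] * (Ahat A).[z]^-1))
    * (Phi n)^`().[z]
  - (Theta * ((Y.[z] * U.[z] - V.[z] * W.[z]) * (Ahat A).[z]^-1) + U^`().[z])
    * (Phi n).[z]
  = V^`().[z] * (reversed n (Phi n)).[z].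
Proof.
exact: (second_order_equation (first_order_relation hA hB hw hP hbd hPhi hn)
  (reversed_first_order_relation hA hB hw hP hbd hPhi hn) hz).
Qed.
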